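(* For every integer $n\geq 1$, $$cr(K_{n}\times P_3)\leq 4\left\lfloor\frac{n}{2}\right\rfloor\left\lfloor\frac{n-1}{2}\right\rfloor\left\lfloor\frac{n-2}{2}\right\rfloor\left\lfloor\frac{n-3}{2}\right\rfloor+n\left\lfloor\frac{n-1}{2}\right\rfloor\left\lfloor\frac{n-2}{2}\right\rfloor .$$
   Context: The crossing number $cr(G)$ of a graph $G$ is the smallest number of pairwise crossings of edges among all drawings of $G$ in the plane. The Kronecker product $G\times H$ of graphs $G$ and $H$ has vertex set $V(G)\times V(H)$ and edge set $\{\{(a,x),(b,y)\} : \{a,b\}\in E(G),\ \{x,y\}\in E(H)\}$. $K_n$ is the complete graph on $n$ vertices and $P_3$ is the path on $3$ vertices. Thus $K_n\times P_3$ has vertices $0i,1i,2i$ ($0\leq i\leq n-1$) and edges $(0i,1j),(2i,1j)$ for $0\leq i\neq j\leq n-1$. *)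

(* Defs.v *)
From HB Require Import structures.
From mathcomp Require Import all_boot all_order all_algebra.
From mathcomp Require Import all_classical all_reals all_analysis.
From mathcomp Require Import ring lra.
Import Order.TTheory GRing.Theory Num.Theory.
Import numFieldNormedType.Exports.

Set Implicit Arguments.
Unset Strict Implicit.
Unset Printing Implicit Defensive.

Local Open Scope classical_set_scope.
Local Open Scope ring_scope.
Local Open Scope card_scope.

Record sgraph := SGraph {
  vertex :> finType;
  adj : rel vertex;
  adj_sym : symmetric adj;
  adj_irrefl : irreflexive adj }.

Definition edges (G : sgraph) : {set {set G}} :=
  [set [set p.1; p.2]%SET | p : G * G & adj p.1 p.2]%SET.

Definition complete_rel n : rel 'I_n := [rel i j : 'I_n | i != j].

Fact complete_sym n : symmetric (@complete_rel n).
Proof. by move=> i j; rewrite /complete_rel /= eq_sym. Qed.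

Fact complete_irrefl n : irreflexive (@complete_rel n).
Proof. by move=> i; rewrite /complete_rel /= eqxx. Qed.

Definition complete_graph n : sgraph :=
  SGraph (@complete_sym n) (@complete_irrefl n).

Definition path_rel n : rel 'I_n := [rel i j : 'I_n | (i.+1 == j :> nat) || (j.+1 == i :> nat)].

Fact path_sym n : symmetric (@path_rel n).
Proof. by move=> i j; rewrite /path_rel /= orbC. Qed.

Fact path_irrefl n : irreflexive (@path_rel n).
Proof. by move=> i; rewrite /path_rel /= orbb gtn_eqF. Qed.

Definition path_graph n : sgraph := SGraph (@path_sym n) (@path_irrefl n).

Section Kronecker.
Variables G H : sgraph.

Definition kronecker_rel : rel (G * H) :=
  [rel u v : G * H | adj u.1 v.1 && adj u.2 v.2].

Fact kronecker_sym : symmetric kronecker_rel.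
Proof. by move=> u v; rewrite /kronecker_rel /= adj_sym [X in _ && X]adj_sym. Qed.

Fact kronecker_irrefl : irreflexive kronecker_rel.
Proof. by move=> u; rewrite /kronecker_rel /= adj_irrefl. Qed.

Definition kronecker : sgraph := SGraph kronecker_sym kronecker_irrefl.

End Kronecker.

(* A drawing in the plane R * R: vertices are distinct points, and each edge is
   a simple arc joining its two ends (in either direction) whose interior
   contains no vertex. [arc] is only meaningful on [edges G]. *)
Record drawing (R : realType) (G : sgraph) := Drawing {
  point_of : G -> R * R;
  arc : {set G} -> R -> R * R;
  point_of_inj : injective point_of;
  arc_continuous : forall e, e \in edges G ->
    {within `[0, 1], continuous (arc e)};
  arc_simple : forall e, e \in edges G -> {in `[0, 1] &, injective (arc e)};
  arc_ends : forall e, e \in edges G ->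
    [set arc e 0; arc e 1] = point_of @` [set v | v \in e];
  arc_avoids : forall e v t, e \in edges G -> t \in `]0, 1[ ->
    arc e t <> point_of v }.

Definition arc_interior (R : realType) (G : sgraph) (D : drawing R G)
  (e : {set G}) : set (R * R) := arc D e @` `]0, 1[.

(* A crossing is an unordered pair of distinct edges together with an interior
   point they share. Hence a pair meeting k times contributes k, a point common
   to m edges contributes 'C(m, 2), and a tangency counts as a crossing. *)
Definition crossings (R : realType) (G : sgraph) (D : drawing R G) :
    set ({set {set G}} * (R * R)) :=
  [set c : {set {set G}} * (R * R) | [/\ c.1 \subset edges G, #|c.1| = 2%N &
               forall e, e \in c.1 -> arc_interior D e c.2]].

Definition has_drawing_with (R : realType) (G : sgraph) (k : nat) : Prop :=
  exists D : drawing R G, crossings D #= `I_k.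

(* Every graph has a drawing with finitely many crossings: put the vertices on
   the parabola Y = X ^+ 2 and draw the edges as segments. *)
Section ParabolaDrawing.
Variables (R : realType) (G : sgraph).

Definition par_x (v : G) : R := (enum_rank v)%:R.
Definition par_pt (v : G) : R * R := (par_x v, par_x v ^+ 2).

Definition par_arc (e : {set G}) (t : R) : R * R :=
  if [pick p : G * G | adj p.1 p.2 && (e == [set p.1; p.2]%SET)] is Some p
  then (par_x p.1 + t * (par_x p.2 - par_x p.1),
        par_x p.1 ^+ 2 + t * (par_x p.2 ^+ 2 - par_x p.1 ^+ 2))
  else (0, 0).

Lemma par_x_inj : injective par_x.
Proof.
move=> u v /eqP; rewrite eqr_nat => /eqP uv.
by apply: enum_rank_inj; apply: val_inj.
Qed.

Lemma par_arcE e : e \in edges G -> exists p : G * G,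
  [/\ e = [set p.1; p.2]%SET, par_x p.1 != par_x p.2 &
      par_arc e = fun t => (par_x p.1 + t * (par_x p.2 - par_x p.1),
        par_x p.1 ^+ 2 + t * (par_x p.2 ^+ 2 - par_x p.1 ^+ 2))].
Proof.
move=> /imsetP[p]; rewrite inE => adjp eE.
rewrite /par_arc; case: pickP => [q /andP[adjq /eqP eq]|/(_ p)]; last first.
  by rewrite adjp eE eqxx.
exists q; split=> //; apply: contraTneq adjq => /par_x_inj ->.
by rewrite adj_irrefl.
Qed.

Fact par_pt_inj : injective par_pt.
Proof. by move=> u v [/par_x_inj]. Qed.

Fact par_arc_continuous e : e \in edges G ->
  {within `[0, 1], continuous (par_arc e)}.
Proof.
have lin (a c : R) : continuous (fun t : R => a + t * c).
  move=> t; apply: cvgD; first exact: cvg_cst.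
  by apply: cvgM; [exact: cvg_id|exact: cvg_cst].
move=> /par_arcE[p [_ _ ->]]; apply: continuous_subspaceT => t.
exact: (cvg_pair (lin _ _ t) (lin _ _ t)).
Qed.

Fact par_arc_simple e : e \in edges G ->
  {in `[0, 1] &, injective (par_arc e)}.
Proof.
move=> /par_arcE[p [_ neq ->]] s t _ _ [/addrI/mulIf + _]; apply.
by rewrite subr_eq0 eq_sym.
Qed.

Fact par_arc_ends e : e \in edges G ->
  [set par_arc e 0; par_arc e 1] = par_pt @` [set v | v \in e].
Proof.
move=> /par_arcE[p [-> _ ->]].
rewrite !mul0r !mul1r !addr0 ![_ + (_ - _)]addrC !subrK.
apply/seteqP; split=> [z /= [] ->|z /= [v + <-]].
- by exists p.1 => //; rewrite !inE eqxx.
- by exists p.2 => //; rewrite !inE eqxx orbT.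
- by rewrite !inE => /orP[] /eqP ->; [left|right].
Qed.

Fact par_arc_avoids e v t : e \in edges G -> t \in `]0, 1[ ->
  par_arc e t <> par_pt v.
Proof.
move=> /par_arcE[p [_ neq ->]]; rewrite in_itv /= => /andP[t0 t1] [].
set a := par_x p.1; set b := par_x p.2 => <- /eqP.
rewrite -subr_eq0.
have -> : a ^+ 2 + t * (b ^+ 2 - a ^+ 2) - (a + t * (b - a)) ^+ 2 =
  t * (1 - t) * (a - b) ^+ 2 by ring.
by rewrite !mulf_eq0 !subr_eq0 (negPf neq) !gt_eqF.
Qed.

Definition par_drawing : drawing R G :=
  Drawing par_pt_inj par_arc_continuous par_arc_simple par_arc_ends
    par_arc_avoids.

Lemma par_meet e f z w : e \in edges G -> f \in edges G -> e != f ->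
  arc_interior par_drawing e z -> arc_interior par_drawing f z ->
  arc_interior par_drawing e w -> arc_interior par_drawing f w -> z = w.
Proof.
have lineP g y : g \in edges G -> arc_interior par_drawing g y ->
    forall x : R * R, arc_interior par_drawing g x ->
    exists p : G * G, [/\ g = [set p.1; p.2]%SET,
      y.2 = (par_x p.1 + par_x p.2) * y.1 - par_x p.1 * par_x p.2 &
      x.2 = (par_x p.1 + par_x p.2) * x.1 - par_x p.1 * par_x p.2].
  move=> gG [t _ <-] x [s _ <-] /=; have [p [gE _ ->]] := par_arcE gG.
  by exists p; split=> //=; ring.
move=> eG fG ef ez fz ew fw.
have [p [eE pz pw]] := lineP _ _ eG ez _ ew.
have [q [fE qz qw]] := lineP _ _ fG fz _ fw.
move: pz pw qz qw ef; rewrite eE fE {eE fE}.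
move: p q => [p1 p2] [q1 q2] /=.
have [sE|sN] := eqVneq (par_x p1 + par_x p2) (par_x q1 + par_x q2).
  move=> pz pw qz qw.
  have pE : par_x p1 * par_x p2 = par_x q1 * par_x q2.
    by apply: oppr_inj; move: pz; rewrite qz sE => /addrI.
  have /eqP : (par_x p1 - par_x q1) * (par_x p1 - par_x q2) = 0.
    transitivity (par_x p1 ^+ 2 - par_x p1 * (par_x q1 + par_x q2)
                  + par_x q1 * par_x q2); first by ring.
    by rewrite -sE -pE; ring.
  rewrite mulf_eq0 !subr_eq0 => /orP[] /eqP E.
    move: sE; rewrite E => /addrI/par_x_inj ->.
    by move/par_x_inj: E => ->; rewrite eqxx.
  move: sE; rewrite E addrC => /addIr/par_x_inj ->.
  by move/par_x_inj: E => ->; rewrite finset.setUC eqxx.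
case: z {ez fz} => z1 z2; case: w {ew fw} => w1 w2 /= pz pw qz qw _.
suff zw : z1 = w1 by rewrite zw pz pw zw.
have : (par_x p1 + par_x p2 - (par_x q1 + par_x q2)) * (z1 - w1) = 0.
  move: pz pw; rewrite qz qw => pz pw.
  lra.
by move/eqP; rewrite mulf_eq0 !subr_eq0 (negPf sN) /= => /eqP.
Qed.

Lemma par_crossings_finite : finite_set (crossings par_drawing).
Proof.
have inj : {in crossings par_drawing &, injective fst}.
  move=> [S z] [T w]; rewrite !inE => -[/= SG S2 Sz] [/= _ _ Tw] ST.
  move: ST Tw => <- Sw.
  have /cards2P[e [f [ef SE]]] : #|S| == 2%N by rewrite S2.
  have eS : e \in S by rewrite SE !inE eqxx.
  have fS : f \in S by rewrite SE !inE eqxx orbT.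
  rewrite (par_meet (fintype.subsetP SG _ eS) (fintype.subsetP SG _ fS) ef
    (Sz _ eS) (Sz _ fS) (Sw _ eS) (Sw _ fS)) //.
rewrite -(eq_finite_set (inj_card_eq inj)); exact: finite_finset.
Qed.

End ParabolaDrawing.

Fact has_drawing (R : realType) (G : sgraph) :
  exists k, `[< has_drawing_with R G k >].
Proof.
have /finite_setP[k Dk] := @par_crossings_finite R G.
by exists k; apply/asboolP; exists (par_drawing R G).
Qed.

(* The least number of crossings over all drawings; drawings with infinitely
   many crossings are irrelevant. *)
Definition crossing_number (R : realType) (G : sgraph) : nat :=
  ex_minn (has_drawing R G).

(* Main.v *)
(* Give each vertex v a point t_v of the real line and a sign s_v, and place it at
   the vector s_v (1, t_v, t_v^2) of R^3; draw the edge uv as the cone spanned by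
   the two vectors, and project the rays of R^3 stereographically from (0, 0, 1),
   a ray of the moment cone which lies in none of these cones. As any three points
   of the moment curve are independent, two edges meet at most once, and whether
   they do is decided by the order and the signs of their four ends.

   For K_n x P_3 take the order 0_0 2_0 1_0 0_1 2_1 1_1 0_2 2_2 1_2 ..., the sign
   (-1)^i for 0i and 2i and the opposite sign for 1i, so that 1i is nearly the
   antipode of 0i and 2i; for odd n, exchange 1_0 and 0_1.

   Among the pairs of edges joining P, Q in {0i, 2i} to J, L in {1i}, at most one of
   {PJ, QL} and {PL, QJ} crosses, and a crossing forces two parity conditions. Hence
   4 times the number of crossings is at most the number of (P, Q, J, L) satisfying
   both, which is a polynomial in signs; it is a combination of squares of sums
   such as sum_J (-1)^J a_PJ a_QJ, with a_PJ the sign of the order of P and J. For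
   distinct indices the alternation of signs makes these sums 0 for even n, and 1
   or 2 for odd n; the exchange made for odd n cancels some that would equal 2. *)

Require Import Defs.
From mathcomp Require Import all_boot all_order all_algebra.
From mathcomp Require Import all_classical all_reals all_analysis.
From mathcomp Require Import ring lra zify.
Import Order.TTheory GRing.Theory Num.Theory.
Import numFieldNormedType.Exports.

Set Implicit Arguments.
Unset Strict Implicit.
Unset Printing Implicit Defensive.

Local Open Scope classical_set_scope.
Local Open Scope card_scope.
Local Open Scope ring_scope.

(** * Drawings on the moment curve *)

Section MomentCurveDrawing.
Variables (R : realType) (G : sgraph) (tau : G -> R) (sgn : G -> bool).
Hypothesis tau_inj : injective tau.

(* The denominator of the stereographic projection from (0, 0, 1); it vanishes only
   on the closed ray of that point. *)
Definition stereo_den (x y z : R) : R := Num.sqrt (x ^+ 2 + y ^+ 2 + z ^+ 2) - z.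

Definition stereo (x y z : R) : R * R :=
  (x / stereo_den x y z, y / stereo_den x y z).

Lemma stereo_den_gt0 x y z : (x, y) != (0, 0) -> 0 < stereo_den x y z.
Proof.
move=> xy; have xy0 : 0 < x ^+ 2 + y ^+ 2.
  rewrite lt0r paddr_eq0 ?sqr_ge0// !sqrf_eq0 addr_ge0 ?sqr_ge0// andbT.
  by move: xy; rewrite xpair_eqE.
rewrite subr_gt0 (le_lt_trans (ler_norm z))// -sqrtr_sqr ltr_sqrt; first lra.
have := sqr_ge0 z; lra.
Qed.

(** With d the denominator, d + z is the norm, so d^2 + 2 d z = x^2 + y^2 and z / d is determined by
    the image (x / d, y / d). Vectors with equal images thus differ by the factor d / d'. *)
Lemma stereo_ray x y z x' y' z' : (x, y) != (0, 0) -> (x', y') != (0, 0) ->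
  stereo x y z = stereo x' y' z' ->
  exists c, [/\ 0 < c, x = c * x', y = c * y' & z = c * z'].
Proof.
move=> n0 n0'; rewrite /stereo.
have := stereo_den_gt0 z n0; have := stereo_den_gt0 z' n0'.
have : (stereo_den x y z + z) ^+ 2 = x ^+ 2 + y ^+ 2 + z ^+ 2.
  by rewrite subrK sqr_sqrtr// !addr_ge0 ?sqr_ge0.
have : (stereo_den x' y' z' + z') ^+ 2 = x' ^+ 2 + y' ^+ 2 + z' ^+ 2.
  by rewrite subrK sqr_sqrtr// !addr_ge0 ?sqr_ge0.
move: (stereo_den x y z) (stereo_den x' y' z') => d d' dE' dE d'0 d0 [xE yE].
have E u v : u / d = v / d' -> u = d / d' * v.
  by move=> uv; rewrite mulrAC -mulrA -uv mulrCA mulfV ?mulr1// gt_eqF.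
move/E: xE => xE; move/E: yE => yE.
exists (d / d'); split; [exact: divr_gt0 | exact: xE | exact: yE | ].
have e1 : d ^+ 2 + 2 * d * z = x ^+ 2 + y ^+ 2 by move: dE; rewrite sqrrD; lra.
have e2 : d' ^+ 2 + 2 * d' * z' = x' ^+ 2 + y' ^+ 2
  by move: dE'; rewrite sqrrD; lra.
have : 2 * d * z = 2 * d * (d / d' * z').
  have -> : 2 * d * z = x ^+ 2 + y ^+ 2 - d ^+ 2 by lra.
  rewrite xE yE !exprMn -mulrDr -e2; field.
  by rewrite gt_eqF.
by apply: mulfI; rewrite mulf_neq0 ?gt_eqF// pnatr_eq0.
Qed.

(** * Vectors on the moment curve and the cones they span *)

Definition coef (v : G) (i : nat) : R := (-1) ^+ sgn v * tau v ^+ i.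

(** The three relations are combined with the coefficients of (X - t2)(X - t3), which removes c2 and
    c3. [vandermonde4] uses (X - t3)(X - t4) in the same way. *)
Lemma vandermonde3 (t1 t2 t3 c1 c2 c3 : R) : t1 != t2 -> t1 != t3 ->
  c1 + c2 + c3 = 0 -> c1 * t1 + c2 * t2 + c3 * t3 = 0 ->
  c1 * t1 ^+ 2 + c2 * t2 ^+ 2 + c3 * t3 ^+ 2 = 0 -> c1 = 0.
Proof.
move=> t12 t13 e0 e1 e2.
have : c1 * ((t1 - t2) * (t1 - t3)) =
   (c1 * t1 ^+ 2 + c2 * t2 ^+ 2 + c3 * t3 ^+ 2)
   - (t2 + t3) * (c1 * t1 + c2 * t2 + c3 * t3) + t2 * t3 * (c1 + c2 + c3).
  by ring.
rewrite e0 e1 e2 !mulr0 subr0 addr0 => /eqP.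
by rewrite !mulf_eq0 !subr_eq0 (negPf t12) (negPf t13) !orbF => /eqP.
Qed.

Lemma vandermonde4 (t1 t2 t3 t4 c1 c2 c3 c4 : R) :
  c1 + c2 + c3 + c4 = 0 -> c1 * t1 + c2 * t2 + c3 * t3 + c4 * t4 = 0 ->
  c1 * t1 ^+ 2 + c2 * t2 ^+ 2 + c3 * t3 ^+ 2 + c4 * t4 ^+ 2 = 0 ->
  c1 * ((t1 - t3) * (t1 - t4)) = - (c2 * ((t2 - t3) * (t2 - t4))).
Proof.
move=> e0 e1 e2; apply/eqP; rewrite -addr_eq0; apply/eqP.
transitivity ((c1 * t1 ^+ 2 + c2 * t2 ^+ 2 + c3 * t3 ^+ 2 + c4 * t4 ^+ 2)
   - (t3 + t4) * (c1 * t1 + c2 * t2 + c3 * t3 + c4 * t4)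
   + t3 * t4 * (c1 + c2 + c3 + c4)); first by ring.
by rewrite e0 e1 e2 !mulr0 subr0 addr0.
Qed.

(** Strict positivity restricts to the open cones, as only interior points of arcs count as
    crossings. *)
Definition cones_meet (p q a b : G) : Prop := exists x y z w : R,
  [/\ 0 < x, 0 < y, 0 < z, 0 < w &
      forall i, (i < 3)%N ->
        x * coef p i + y * coef q i = z * coef a i + w * coef b i].

Lemma cones_meet_flip p q a b : cones_meet p q a b -> cones_meet q p a b.
Proof.
move=> [x [y [z [w [x0 y0 z0 w0 E]]]]]; exists y, x, z, w; split=> // i i3.
by rewrite addrC E.
Qed.

Lemma cones_meet_swap p q a b : cones_meet p q a b -> cones_meet a b p q.
Proof.
move=> [x [y [z [w [x0 y0 z0 w0 E]]]]]; exists z, w, x, y; split=> // i i3.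
by rewrite E.
Qed.

Definition chord (p q : G) (t : R) (i : nat) : R :=
  (1 - t) * coef p i + t * coef q i.

(** This keeps the arcs away from the centre of projection. If both coordinates vanish, then t s_q
    (t_q - t_p) = 0, so t = 0, where the first coordinate is the sign s_p. *)
Lemma chord_neq0 p q t : p != q -> (chord p q t 0, chord p q t 1) != (0, 0).
Proof.
move=> pq; apply/eqP => -[]; rewrite /chord /coef !expr0 !mulr1 !expr1 => e0 e1.
have tpq : tau p != tau q by apply: contra_neq pq => /tau_inj.
have : t * (-1) ^+ sgn q * (tau q - tau p) = 0.
  transitivity ((1 - t) * ((-1) ^+ sgn p * tau p) + t * ((-1) ^+ sgn q * tau q)
    - tau p * ((1 - t) * (-1) ^+ sgn p + t * (-1) ^+ sgn q)); first by ring.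
  by rewrite e0 e1 mulr0 subr0.
move/eqP; rewrite !mulf_eq0 signr_eq0 orbF subr_eq0 [_ == tau p]eq_sym.
rewrite (negPf tpq) orbF => /eqP t0.
by move: e0 => /eqP; rewrite t0 subr0 mul1r mul0r addr0 signr_eq0.
Qed.

(** * The drawing given by points of the line and signs *)

Definition curve (p q : G) (t : R) : R * R :=
  stereo (chord p q t 0) (chord p q t 1) (chord p q t 2).

Definition moment_point (v : G) : R * R := stereo (coef v 0) (coef v 1) (coef v 2).

(** An edge is an unordered set, so [pick] chooses an orientation; (0, 0) is a default value, never
    taken on [edges G]. *)
Definition moment_arc (e : {set G}) (t : R) : R * R :=
  if [pick p : G * G | adj p.1 p.2 && (e == [set p.1; p.2]%SET)] is Some p
  then curve p.1 p.2 t else (0, 0).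

Lemma adj_neq (p q : G) : adj p q -> p != q.
Proof. by apply: contraTneq => ->; rewrite adj_irrefl. Qed.

Lemma moment_arcE e : e \in edges G -> exists p : G * G,
  [/\ e = [set p.1; p.2]%SET, adj p.1 p.2 & moment_arc e = curve p.1 p.2].
Proof.
move=> /imsetP[p]; rewrite inE => adjp eE.
rewrite /moment_arc; case: pickP => [q /andP[adjq /eqP eq]|/(_ p)]; last first.
  by rewrite adjp eE eqxx.
by exists q.
Qed.

Lemma coef_neq0 v : (coef v 0, coef v 1) != (0, 0).
Proof.
by apply/eqP => -[/eqP]; rewrite /coef expr0 mulr1 signr_eq0.
Qed.

Lemma moment_point_inj : injective moment_point.
Proof.
move=> u v /(stereo_ray (coef_neq0 u) (coef_neq0 v)) [c [c0 + + _]].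
rewrite /coef !expr0 !expr1 !mulr1 => e0; rewrite e0 -mulrA.
move/(mulfI (lt0r_neq0 c0)).
by move/(mulfI (negbT (signr_eq0 _ _))) => /tau_inj.
Qed.

Lemma chord_continuous p q i : continuous (fun t => chord p q t i).
Proof.
move=> t; rewrite /chord; apply: cvgD; apply: cvgM; try exact: cvg_cst.
  by apply: cvgB; [exact: cvg_cst|exact: cvg_id].
exact: cvg_id.
Qed.

Lemma curve_continuous p q : p != q -> continuous (curve p q).
Proof.
move=> pq t.
have c0 := @chord_continuous p q 0 t.
have c1 := @chord_continuous p q 1 t.
have c2 := @chord_continuous p q 2 t.
have n0 := lt0r_neq0 (stereo_den_gt0 (chord p q t 2) (chord_neq0 t pq)).
have cd : {for t, continuous (fun t =>
    stereo_den (chord p q t 0) (chord p q t 1) (chord p q t 2))}.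
  rewrite /stereo_den; apply: cvgB => //.
  apply: (@continuous_comp _ _ _ (fun t => _) (@Num.sqrt R)); last first.
    exact: sqrt_continuous.
  by apply: cvgD; [apply: cvgD|]; apply: cvgM.
have cx : {for t, continuous (fun t => chord p q t 0 /
    stereo_den (chord p q t 0) (chord p q t 1) (chord p q t 2))}.
  by apply: cvgM => //; exact: cvgV.
have cy : {for t, continuous (fun t => chord p q t 1 /
    stereo_den (chord p q t 0) (chord p q t 1) (chord p q t 2))}.
  by apply: cvgM => //; exact: cvgV.
exact: (cvg_pair cx cy).
Qed.


Lemma coef_free2 u v x y : u != v -> x * coef u 0 + y * coef v 0 = 0 ->
  x * coef u 1 + y * coef v 1 = 0 -> x = 0.
Proof.
move=> uv; rewrite /coef !expr0 !expr1 !mulr1 => e0 e1.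
have tuv : tau u != tau v by apply: contra_neq uv => /tau_inj.
have : x * (-1) ^+ sgn u * (tau u - tau v) = 0.
  transitivity (x * ((-1) ^+ sgn u * tau u) + y * ((-1) ^+ sgn v * tau v)
    - tau v * (x * (-1) ^+ sgn u + y * (-1) ^+ sgn v)); first by ring.
  by rewrite e0 e1 mulr0 subr0.
move/eqP; rewrite !mulf_eq0 signr_eq0 orbF subr_eq0.
by rewrite (negPf tuv) orbF => /eqP.
Qed.

Lemma coef_free3 u v w x y z : u != v -> u != w ->
  (forall i, (i < 3)%N -> x * coef u i + y * coef v i + z * coef w i = 0) ->
  x = 0.
Proof.
move=> uv uw E.
have tuv : tau u != tau v by apply: contra_neq uv => /tau_inj.
have tuw : tau u != tau w by apply: contra_neq uw => /tau_inj.
suff : x * (-1) ^+ sgn u = 0.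
  by move/eqP; rewrite mulf_eq0 signr_eq0 orbF => /eqP.
apply: (@vandermonde3 _ _ _ _ (y * (-1) ^+ sgn v) (z * (-1) ^+ sgn w) tuv tuw);
  [rewrite -[RHS](E 0 isT)|rewrite -[RHS](E 1 isT)|rewrite -[RHS](E 2 isT)];
  by rewrite /coef; ring.
Qed.

Lemma curve_eq p q a b s t : p != q -> a != b -> curve p q s = curve a b t ->
  exists2 c, 0 < c & forall i, (i < 3)%N -> chord p q s i = c * chord a b t i.
Proof.
move=> pq ab /(stereo_ray (chord_neq0 s pq) (chord_neq0 t ab))[c [c0 e0 e1 e2]].
by exists c => // -[|[|[|]]].
Qed.

(** Independence of the two vectors gives 1 - s = c (1 - t) and s = c t; adding these, c = 1. *)
Lemma curve_inj p q : p != q -> injective (curve p q).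
Proof.
move=> pq s t /(curve_eq pq pq)[c c0 E].
have lin x y i : chord p q x i - c * chord p q y i =
    ((1 - x) - c * (1 - y)) * coef p i + (x - c * y) * coef q i.
  by rewrite /chord; ring.
have e0 : chord p q s 0 - c * chord p q t 0 = 0 by rewrite E// subrr.
have e1 : chord p q s 1 - c * chord p q t 1 = 0 by rewrite E// subrr.
rewrite !lin in e0 e1.
have /eqP := coef_free2 pq e0 e1; rewrite addrC in e0; rewrite addrC in e1.
have qp : q != p by rewrite eq_sym.
have /eqP := coef_free2 qp e0 e1.
rewrite !subr_eq0 => /eqP st /eqP; rewrite st => h.
have c1 : c = 1 by lra.
by rewrite c1 mul1r.
Qed.

Lemma curve0 p q : curve p q 0 = moment_point p.
Proof. by rewrite /curve /chord /moment_point !subr0 !mul0r !mul1r !addr0. Qed.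

Lemma curve1 p q : curve p q 1 = moment_point q.
Proof. by rewrite /curve /chord /moment_point !subrr !mul0r !mul1r !add0r. Qed.

Lemma moment_arc_continuous e : e \in edges G ->
  {within `[0, 1], continuous (moment_arc e)}.
Proof.
move=> /moment_arcE[p [_ /adj_neq pq ->]]; apply: continuous_subspaceT.
exact: curve_continuous.
Qed.

Lemma moment_arc_simple e : e \in edges G -> {in `[0, 1] &, injective (moment_arc e)}.
Proof. by move=> /moment_arcE[p [_ /adj_neq pq ->]] s t _ _ /curve_inj; apply. Qed.

Lemma moment_arc_ends e : e \in edges G ->
  ([set moment_arc e 0; moment_arc e 1] = moment_point @` [set v | v \in e]).
Proof.
move=> /moment_arcE[p [-> _ ->]]; rewrite curve0 curve1.
apply/seteqP; split=> [z /= [] ->|z /= [v + <-]].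
- by exists p.1 => //; rewrite !inE eqxx.
- by exists p.2 => //; rewrite !inE eqxx orbT.
- by rewrite !inE => /orP[] /eqP ->; [left|right].
Qed.

(** If [v] is an end of the edge, the other end has the nonzero coefficient [t] or [1 - t], against
    independence of two vectors; otherwise three vectors are independent. *)
Lemma moment_arc_avoids e v t : e \in edges G -> t \in `]0, 1[ ->
  moment_arc e t <> moment_point v.
Proof.
move=> /moment_arcE[[p q] /= [_ /adj_neq pq ->]]; rewrite in_itv /= => /andP[t0 t1].
move=> /(stereo_ray (chord_neq0 t pq) (coef_neq0 v))[c [c0 e0 e1 e2]].
have E i : (i < 3)%N -> (1 - t) * coef p i + t * coef q i = c * coef v i.
  by case: i => [|[|[|]]].
have [vp|vp] := eqVneq v p.
  have E' i : (i < 3)%N -> t * coef q i + ((1 - t) - c) * coef p i = 0.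
    by move=> /E; rewrite vp => h; lra.
  have qp : q != p by rewrite eq_sym.
  by have := coef_free2 qp (E' 0 isT) (E' 1 isT); lra.
have [vq|vq] := eqVneq v q.
  have E' i : (i < 3)%N -> (1 - t) * coef p i + (t - c) * coef q i = 0.
    by move=> /E; rewrite vq => h; lra.
  by have := coef_free2 pq (E' 0 isT) (E' 1 isT); lra.
suff : - c = 0 by lra.
apply: (@coef_free3 v p q (- c) (1 - t) t) => // i /E h.
by lra.
Qed.

Definition moment_drawing : drawing R G :=
  Drawing moment_point_inj moment_arc_continuous moment_arc_simple
    moment_arc_ends moment_arc_avoids.

(** * When and how often two cones meet *)

Lemma coef_rel4 u v w r c1 c2 c3 c4 : (forall i, (i < 3)%N ->
    c1 * coef u i + c2 * coef v i + c3 * coef w i + c4 * coef r i = 0) ->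
  c1 * ((-1) ^+ sgn u * ((tau u - tau w) * (tau u - tau r))) =
  - (c2 * ((-1) ^+ sgn v * ((tau v - tau w) * (tau v - tau r)))).
Proof.
move=> E; rewrite !mulrA -[LHS]mulrA -[in RHS]mulrA.
apply: (@vandermonde4 _ _ _ _ _ _ (c3 * (-1) ^+ sgn w) (c4 * (-1) ^+ sgn r));
  [rewrite -[RHS](E 0 isT)|rewrite -[RHS](E 1 isT)|rewrite -[RHS](E 2 isT)];
  by rewrite /coef; ring.
Qed.

(** Two edges without a common end meet at most once: eliminating the vectors of [a] and [b] fixes
    the ratio of x to y, the factor at [p] being nonzero since [p] differs from [a] and [b]. *)
Lemma cones_meet_ratio p q a b x y z w x' y' z' w' :
  p != a -> p != b ->
  (forall i, (i < 3)%N ->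
    x * coef p i + y * coef q i = z * coef a i + w * coef b i) ->
  (forall i, (i < 3)%N ->
    x' * coef p i + y' * coef q i = z' * coef a i + w' * coef b i) ->
  x * y' = x' * y.
Proof.
move=> pa pb E E'.
have tpa : tau p != tau a by apply: contra_neq pa => /tau_inj.
have tpb : tau p != tau b by apply: contra_neq pb => /tau_inj.
have := @coef_rel4 p q a b x y (- z) (- w) ltac:(by move=> i /E h; lra).
have := @coef_rel4 p q a b x' y' (- z') (- w') ltac:(by move=> i /E' h; lra).
set K := (X in x' * X = _); set L := (X in _ = - (y' * X)) => e' e.
have K0 : K != 0 by rewrite !mulf_neq0 ?signr_eq0 ?subr_eq0.
rewrite -/K -/L in e; move: K L K0 e e' => K L K0 e e'.
apply: (mulIf K0); transitivity (x * K * y'); first by ring.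
by rewrite e; transitivity (x' * K * y); [rewrite e'; ring|ring].
Qed.

(* True when tau v and tau w are on different sides of tau u. *)
Definition side (u v w : G) : bool :=
  (tau u < tau v) (+) (tau u < tau w).

Lemma side_sign u v w : u != v -> u != w -> exists2 d : R, 0 < d &
  (tau u - tau v) * (tau u - tau w) = (-1) ^+ side u v w * d.
Proof.
move=> uv uw.
have tuv : tau u != tau v by apply: contra_neq uv => /tau_inj.
have tuw : tau u != tau w by apply: contra_neq uw => /tau_inj.
exists (`|tau u - tau v| * `|tau u - tau w|).
  by rewrite mulr_gt0// normr_gt0 subr_eq0.
rewrite [LHS](_ : _ = ((-1) ^+ (tau u < tau v)%R * `|tau u - tau v|) *
   ((-1) ^+ (tau u < tau w)%R * `|tau u - tau w|)).
  by rewrite /side signr_addb; ring.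
by congr (_ * _); rewrite -subr_lt0 mulr_sign_norm.
Qed.

(** By [coef_rel4], c1 K = - c2 L, where the signs of K and L are the two compared Booleans. As c1 >
    0, they agree exactly when c2 < 0. *)
Lemma coef_rel4_side u v w r c1 c2 c3 c4 :
  u != w -> u != r -> v != w -> v != r -> 0 < c1 -> c2 != 0 ->
  (forall i, (i < 3)%N ->
    c1 * coef u i + c2 * coef v i + c3 * coef w i + c4 * coef r i = 0) ->
  (sgn u (+) side u w r == sgn v (+) side v w r) = (c2 < 0).
Proof.
move=> uw ur vw vr c1_gt0 c2_neq0 /coef_rel4.
have [d d0 ->] := side_sign uw ur; have [e e0 ->] := side_sign vw vr.
rewrite ![(-1) ^+ _ * (_ * _)]mulrA -!signr_addb !mulrA.
rewrite ![_ * (-1) ^+ _]mulrC -!mulrA.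
have := mulr_gt0 c1_gt0 d0; have [c20|c20|c20] := ltgtP c2 0; last first.
- by rewrite c20 eqxx in c2_neq0.
- have := mulr_gt0 c20 e0.
  by case: (_ (+) _); case: (_ (+) _); rewrite !(expr0, expr1)//=; lra.
have : 0 < - c2 * e by rewrite mulr_gt0// oppr_gt0.
by case: (_ (+) _); case: (_ (+) _); rewrite !(expr0, expr1)//=; lra.
Qed.

(** In the relation x p + y q - z a - w b = 0, the coefficients of p and q have equal signs, those
    of p and a, and of q and b, opposite signs; [coef_rel4_side] is applied to these three pairs. *)
Lemma cones_meet_side p q a b : uniq [:: p; q; a; b] -> cones_meet p q a b ->
  [/\ sgn p (+) side p a b != sgn q (+) side q a b,
      sgn p (+) side p q b = sgn a (+) side a q b &
      sgn q (+) side q p a = sgn b (+) side b p a].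
Proof.
rewrite /= !inE !negb_or => /and4P[/and3P[pq pa pb] /andP[qa qb] ab _].
move=> [x [y [z [w [x0 y0 z0 w0 E]]]]].
split.
- rewrite (@coef_rel4_side p q a b x y (- z) (- w)) ?gt_eqF// => [|i /E h].
    by rewrite -leNgt ltW.
  lra.
- apply/eqP; rewrite (@coef_rel4_side p a q b x (- z) y (- w)) ?oppr_eq0 ?gt_eqF// => [||i /E h].
  + by rewrite oppr_lt0.
  + by rewrite eq_sym.
  + lra.
- apply/eqP; rewrite (@coef_rel4_side q b p a y (- w) x (- z)) ?oppr_eq0 ?gt_eqF// => [||||i /E h].
  + by rewrite oppr_lt0.
  + by rewrite eq_sym.
  + by rewrite eq_sym.
  + by rewrite eq_sym.
  + lra.
Qed.

(** Edges with a common end do not cross: the relation becomes one between the vectors of q, p and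
    b, and independence gives y = 0. *)
Lemma cones_meet_share p q b : p != q -> q != b -> ~ cones_meet p q p b.
Proof.
move=> pq qb [x [y [z [w [x0 y0 z0 w0 E]]]]].
suff : y = 0 by lra.
apply: (@coef_free3 q p b y (x - z) (- w)) => // [|i /E h]; first by rewrite eq_sym.
by lra.
Qed.

Lemma cones_meet_uniq p q a b : p != q -> a != b ->
  [set p; q]%SET != [set a; b]%SET -> cones_meet p q a b -> uniq [:: p; q; a; b].
Proof.
move=> pq ab ef pqab; rewrite /= !inE !negb_or pq ab !andbT.
have qp : q != p by rewrite eq_sym.
have [pa|_] := eqVneq p a.
  case: (@cones_meet_share p q b) => //; last by rewrite {2}pa.
  by apply: contra_neq ef => ->; rewrite pa.
have [pb|_] := eqVneq p b.
  case: (@cones_meet_share p q a) => //; last first.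
    by rewrite {2}pb; apply/cones_meet_swap/cones_meet_flip/cones_meet_swap.
  by apply: contra_neq ef => ->; rewrite pb finset.setUC.
have [qa|_] := eqVneq q a.
  case: (@cones_meet_share q p b) => //; last first.
    by rewrite {2}qa; apply/cones_meet_flip.
  by apply: contra_neq ef => ->; rewrite qa finset.setUC.
have [qb|//] := eqVneq q b.
case: (@cones_meet_share q p a) => //; last first.
  by rewrite {2}qb; apply/cones_meet_flip/cones_meet_swap/cones_meet_flip/cones_meet_swap.
by apply: contra_neq ef => ->; rewrite qb.
Qed.

Lemma curve_meet p q a b s t : p != q -> a != b -> 0 < s < 1 -> 0 < t < 1 ->
  curve p q s = curve a b t -> exists z w, [/\ 0 < z, 0 < w & forall i, (i < 3)%N ->
    (1 - s) * coef p i + s * coef q i = z * coef a i + w * coef b i].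
Proof.
move=> pq ab /andP[s0 s1] /andP[t0 t1] /(curve_eq pq ab)[c c0 E].
exists (c * (1 - t)), (c * t); split.
- by rewrite mulr_gt0// subr_gt0.
- exact: mulr_gt0.
- by move=> i /E; rewrite /chord => ->; ring.
Qed.

(** Each pair of edges has at most one crossing point by [cones_meet_ratio], so [fst] embeds the
    crossings of [moment_drawing] into [X]; in particular they are finite in number. *)
Lemma crossing_number_le_cones (X : {set {set {set G}}}) :
  (forall p q a b, adj p q -> adj a b -> uniq [:: p; q; a; b] ->
    cones_meet p q a b -> [set [set p; q]; [set a; b]]%SET \in X) ->
  (crossing_number R G <= #|X|)%N.
Proof.
move=> XP.
have meet S z : crossings moment_drawing (S, z) -> exists p q a b s t,
    [/\ [/\ adj p q, adj a b & uniq [:: p; q; a; b]],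
     S = [set [set p; q]; [set a; b]]%SET, 0 < s < 1, 0 < t < 1 &
     [/\ moment_arc [set p; q]%SET = curve p q,
         moment_arc [set a; b]%SET = curve a b, z = curve p q s & z = curve a b t]].
  move=> [/= SG /eqP/cards2P[e [f [ef SE]]] Sz].
  have eS : e \in S by rewrite SE !inE eqxx.
  have fS : f \in S by rewrite SE !inE eqxx orbT.
  have [[p q] /= [eE pq marce]] := moment_arcE (fintype.subsetP SG _ eS).
  have [[a b] /= [fE ab marcf]] := moment_arcE (fintype.subsetP SG _ fS).
  have [s /= sI es] := Sz _ eS; have [t /= tI ft] := Sz _ fS.
  rewrite in_itv/= in sI; rewrite in_itv/= in tI.
  exists p, q, a, b, s, t; split=> //; last first.
  - by rewrite -eE -fE -marce -marcf es ft.
  - by rewrite SE eE fE.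
  split=> //; apply: cones_meet_uniq; rewrite ?adj_neq//; first by rewrite -eE -fE.
  have [|z' [w' [z0 w0 E]]] := @curve_meet p q a b s t (adj_neq pq) (adj_neq ab) sI tI.
    by rewrite -marce -marcf es ft.
  exists (1 - s), s, z', w'; split=> //; case/andP: sI => // _; by rewrite subr_gt0.
have mem S z : crossings moment_drawing (S, z) -> S \in X.
  move=> /meet[p [q [a [b [s [t [[pq ab u] -> sI tI [_ _ -> E]]]]]]]].
  have [z' [w' [z0 w0 E']]] := curve_meet (adj_neq pq) (adj_neq ab) sI tI E.
  apply: XP => //; exists (1 - s), s, z', w'; split=> //; case/andP: sI => // _.
  by rewrite subr_gt0.
have inj : {in crossings moment_drawing &, injective fst}.
  move=> [S z] [T z']; rewrite !inE => Sz /[swap] /= <- Sz'.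
  have [p [q [a [b [s [t [[pq ab u] SE sI tI [me mf zs zt]]]]]]]] := meet _ _ Sz.
  have [_ _ Sz2] := Sz'; move: Sz2; rewrite /= SE => Sz2.
  have [s' /= s'I es] := Sz2 [set p; q]%SET ltac:(by rewrite !inE eqxx).
  have [t' /= t'I ft] := Sz2 [set a; b]%SET ltac:(by rewrite !inE eqxx orbT).
  rewrite in_itv/= in s'I; rewrite in_itv/= in t'I.
  have [npq nab] := (adj_neq pq, adj_neq ab).
  have [y1 [y2 [_ _ E]]] := curve_meet npq nab sI tI (etrans (esym zs) zt).
  have zs' : curve p q s' = curve a b t' by rewrite -me -mf es ft.
  have [y1' [y2' [_ _ E']]] := curve_meet npq nab s'I t'I zs'.
  move: u; rewrite /= !inE !negb_or => /andP[/and3P[_ pa pb] _].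
  (* As [curve_meet] keeps the coefficients 1 - s and s, equality of the ratios gives s = s'. *)
  have := cones_meet_ratio pa pb E E' => ss.
  have {}ss : s = s' by lra.
  by rewrite zs ss -me es.
have sub : (fst @` crossings moment_drawing `<=` [set` X]).
  by move=> S [[T z] /mem Tz <-].
have fin : finite_set (crossings moment_drawing).
  rewrite -(eq_finite_set (inj_card_eq inj)).
  exact: sub_finite_set sub (@finite_finset _ _).
have [k kD] := fin.
rewrite /crossing_number; case: ex_minnP => m _ /(_ k) mk.
apply: (leq_trans (mk _)).
  by apply/asboolP; exists moment_drawing.
have kX : `I_k #<= [set` X].
  rewrite -(card_le_eql kD) -(card_le_eql (inj_card_eq inj)).
  exact: subset_card_le.
rewrite -card_le_II; apply: (card_le_trans kX).
have idx : {in [set` X] &, injective (index^~ (enum X))}.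
  move=> S T; rewrite !inE => SX TX ST.
  by rewrite -(nth_index S (_ : S \in enum X)) ?mem_enum// ST nth_index ?mem_enum.
rewrite -(card_le_eql (inj_card_eq idx)); apply: subset_card_le => _ [S SX <-] /=.
by rewrite cardE index_mem mem_enum.
Qed.

End MomentCurveDrawing.

(** * The position of the vertices on the moment curve *)

(* The pair (i, c) stands for the vertex 2i if c holds and for 0i otherwise; [sw]
   exchanges 1_0 and 0_1. *)
Definition outer_pos (sw : bool) (P : nat * bool) : nat :=
  if [&& sw, P.1 == 1 & ~~ P.2]%N then 2 else 3 * P.1 + P.2.

Definition inner_pos (sw : bool) (j : nat) : nat :=
  if sw && (j == 0)%N then 3 else 3 * j + 2.

(** The exchanged positions 2 and 3 are adjacent, so only the order of 0_1 and 1_0 is reversed. *)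
Definition exchanged (sw : bool) (P : nat * bool) (j : nat) : bool :=
  [&& sw, P.1 == 1, ~~ P.2 & j == 0]%N.

Lemma outer_pos_inj sw : injective (outer_pos sw).
Proof.
move=> [i c] [k d]; rewrite /outer_pos /= => h.
have : i = k /\ c = d :> nat.
  by case: sw c d h => -[] [] /=; do ?case: ifP; lia.
by move=> [-> cd]; congr (_, _); case: c d cd {h} => -[].
Qed.

Lemma inner_pos_inj sw : injective (inner_pos sw).
Proof. by move=> j l; rewrite /inner_pos; case: sw => /=; do ?case: ifP; lia. Qed.

Lemma outer_inner_pos_neq sw P j : outer_pos sw P != inner_pos sw j.
Proof.
case: P => i c; rewrite /outer_pos /inner_pos /=.
by case: sw c => -[] /=; do ?case: ifP; lia.
Qed.

Lemma outer_pos_lt sw P Q : P.1 != Q.1 -> (outer_pos sw P < outer_pos sw Q)%N = (P.1 < Q.1)%N.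
Proof.
case: P Q => [i c] [k d]; rewrite /outer_pos /=.
by case: sw c d => -[] [] /=; do ?case: ifP; lia.
Qed.

Lemma inner_pos_lt sw j l : (inner_pos sw j < inner_pos sw l)%N = (j < l)%N.
Proof. by rewrite /inner_pos; case: sw => /=; do ?case: ifP; lia. Qed.

Lemma outer_inner_pos_lt sw P j : P.1 != j ->
  (outer_pos sw P < inner_pos sw j)%N = (P.1 < j)%N (+) exchanged sw P j.
Proof.
case: P => i c; rewrite /outer_pos /inner_pos /exchanged /=.
by case: sw c => -[] /=; do ?case: ifP; lia.
Qed.

Lemma outer_inner_pos_partner sw P : (outer_pos sw P < inner_pos sw P.1)%N.
Proof.
case: P => i c; rewrite /outer_pos /inner_pos /=.
by case: sw c => -[] /=; do ?case: ifP; lia.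
Qed.

(** The three necessary conditions of [cones_meet_side] for the edges from [P] to [j] and from [Q]
    to [l], with sign [odd] at outer vertices and its negation at inner ones. *)
Definition may_cross sw (P : nat * bool) (j : nat) (Q : nat * bool) (l : nat) : bool :=
  let p := outer_pos sw P in let q := outer_pos sw Q in
  let x := inner_pos sw j in let y := inner_pos sw l in
  [&& odd P.1 (+) (p < q) (+) (p < y) != ~~ odd j (+) (x < q) (+) (x < y),
      odd P.1 (+) (p < x) (+) (p < y) == odd Q.1 (+) (q < x) (+) (q < y) &
      ~~ odd j (+) (x < p) (+) (x < q) == ~~ odd l (+) (y < p) (+) (y < q)]%N.

Lemma ltn_swap (m n : nat) : m != n -> (n < m)%N = ~~ (m < n)%N.
Proof. lia. Qed.

(** Reduces [may_cross] to a Boolean formula in four parities and six comparisons, which the lemmas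
    below decide by cases. *)
Lemma may_cross_order sw P j Q l : P != Q -> j != l ->
  let p := outer_pos sw P in let q := outer_pos sw Q in
  let x := inner_pos sw j in let y := inner_pos sw l in
  [/\ (q < p)%N = ~~ (p < q)%N, (y < x)%N = ~~ (x < y)%N,
      ((x < p) = ~~ (p < x))%N /\ ((y < p) = ~~ (p < y))%N &
      ((x < q) = ~~ (q < x))%N /\ ((y < q) = ~~ (q < y))%N].
Proof.
move=> PQ jl p q x y.
have pq : p != q by rewrite (inj_eq (@outer_pos_inj sw)).
have xy : x != y by rewrite (inj_eq (@inner_pos_inj sw)).
by split; [| |split|split]; apply: ltn_swap => //; exact: outer_inner_pos_neq.
Qed.

Lemma may_cross_sym sw P j Q l : P != Q -> j != l -> may_cross sw P j Q l -> may_cross sw Q l P j.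
Proof.
move=> PQ jl; rewrite /may_cross /=; have /= [-> -> [-> ->] [-> ->]] := may_cross_order sw PQ jl.
by case: odd; case: odd; case: odd; case: odd; case: (_ < _)%N; case: (_ < _)%N;
   case: (_ < _)%N; case: (_ < _)%N; case: (_ < _)%N; case: (_ < _)%N.
Qed.

(** Exchanging [j] and [l] preserves the last two conditions of [may_cross] and, given the third,
    negates the first. *)
Lemma may_cross_excl sw P j Q l : P != Q -> j != l ->
  may_cross sw P j Q l -> ~~ may_cross sw P l Q j.
Proof.
move=> PQ jl; rewrite /may_cross /=; have /= [_ -> [-> ->] [-> ->]] := may_cross_order sw PQ jl.
by case: odd; case: odd; case: odd; case: odd; case: (_ < _)%N; case: (_ < _)%N;
   case: (_ < _)%N; case: (_ < _)%N; case: (_ < _)%N; case: (_ < _)%N.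
Qed.

(** The last two conditions of [may_cross] each equate one of the two parities with the sum modulo 2
    of the four comparisons, which is unchanged if all four are negated. *)
Lemma may_cross_parity sw P j Q l : P != Q -> j != l -> may_cross sw P j Q l ->
  let p := outer_pos sw P in let q := outer_pos sw Q in
  let x := inner_pos sw j in let y := inner_pos sw l in
  odd P.1 (+) odd Q.1 = odd j (+) odd l /\
  ((p < x) (+) (q < x) (+) (p < y) (+) (q < y))%N = odd j (+) odd l.
Proof.
move=> PQ jl; rewrite /may_cross /=; have /= [_ _ [-> ->] [-> ->]] := may_cross_order sw PQ jl.
by case: odd; case: odd; case: odd; case: odd; case: (_ < _)%N; case: (_ < _)%N;
   case: (_ < _)%N; case: (_ < _)%N; case: (_ < _)%N; case: (_ < _)%N.
Qed.

(** Needed because [cross_poly] vanishes here although both edges may exist. Without the exchange,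
    [Q] and its partner compare in the same way with [P] and with inner [l], so the first two
    conditions of [may_cross] contradict each other. *)
Lemma may_cross_partner sw P Q l : P.1 != Q.1 -> Q.1 != l -> ~~ may_cross sw P Q.1 Q l.
Proof.
move=> PQ Ql; have PQ' : P != Q by apply: contra_neq PQ => ->.
apply/negP; rewrite /may_cross /=; have /= [_ _ [-> ->] [-> ->]] := may_cross_order sw PQ' Ql.
rewrite (outer_pos_lt sw PQ) (outer_inner_pos_lt sw PQ) (outer_inner_pos_lt sw Ql) inner_pos_lt.
rewrite outer_inner_pos_partner.
set y := inner_pos sw l; have : (outer_pos sw P < y)%N =
    if P.1 == l then true else (P.1 < l)%N (+) exchanged sw P l.
  by rewrite /y; case: eqVneq => [<-|/outer_inner_pos_lt->//]; rewrite outer_inner_pos_partner.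
(* The cases where the exchange reverses the order of [P] and inner [Q.1], or of [Q] and inner [l],
   are checked apart; otherwise [b] is arbitrary. *)
move: (_ < y)%N => b bE; case X: (exchanged sw P Q.1).
  move: X Ql bE; rewrite /exchanged => /and4P[_ /eqP-> _ /eqP->].
  by case: l {y} => [|[|l]] //= _ ->; case: (sw); case: (P.2).
case Y: (exchanged sw Q l).
  move: X Y PQ bE; rewrite /exchanged => + /and4P[_ /eqP-> _ /eqP->].
  case: (P.1) => [|[|i]] //= + _ ->; first by case: (sw); case: (P.2).
  by case: (odd i); case: (sw); case: (P.2).
move: {bE} b => b.
by case: odd; case: odd; case: odd; case: (_ < _)%N; case: (_ < _)%N; case: b.
Qed.

(* The first conjunct orders the two edges of a crossing. *)
Definition crossing_tuple sw P j Q l : bool :=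
  [&& (outer_pos sw P < outer_pos sw Q)%N, P.1 != j, Q.1 != l, j != l & may_cross sw P j Q l].

(** * The polynomial in signs that bounds the crossings *)

Definition ordsign (i j : nat) : int := if i == j then 0 else (-1) ^+ (i < j)%N.

(** The a_PJ of the overview. It is 0 when [P.1 = j], where there is no edge, so sums may run over
    all indices. *)
Definition adjsign sw P j : int := ordsign P.1 j * (-1) ^+ exchanged sw P j.

Definition psign (i : nat) : int := (-1) ^+ odd i.

Definition sign_prod sw P j Q l : int :=
  adjsign sw P j * adjsign sw Q j * (adjsign sw P l * adjsign sw Q l).

(* With w the [sign_prod], e the product of the signs of P and Q, and f that of j
   and l, this is w^2 (1 + w e) (1 + w f), since w is 0 or a sign: it is 4 if the
   edges exist and both parity conditions hold, and 0 otherwise. *)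
Definition cross_poly sw P j Q l : int :=
  sign_prod sw P j Q l ^+ 2 * (1 + psign P.1 * psign Q.1 * (psign j * psign l)) +
  sign_prod sw P j Q l * (psign j * psign l + psign P.1 * psign Q.1).

Lemma adjsignE sw P j : P.1 != j -> adjsign sw P j = (-1) ^+ (outer_pos sw P < inner_pos sw j)%N.
Proof. by move=> Pj; rewrite outer_inner_pos_lt// /adjsign /ordsign (negPf Pj) -signr_addb. Qed.

(** The two indicators exclude each other, and either implies both parity conditions, under which
    the polynomial is 4; in the remaining case it is still nonnegative. *)
Lemma may_cross_le sw P j Q l : P != Q -> j != l ->
  P.1 != j -> P.1 != l -> Q.1 != j -> Q.1 != l ->
  4 * (may_cross sw P j Q l + may_cross sw P l Q j)%:R <= cross_poly sw P j Q l.
Proof.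
move=> PQ jl Pj Pl Qj Ql; have := may_cross_excl PQ jl (sw := sw).
have := may_cross_parity PQ jl (sw := sw).
have : may_cross sw P l Q j -> let p := outer_pos sw P in let q := outer_pos sw Q in
  let x := inner_pos sw j in let y := inner_pos sw l in
  odd P.1 (+) odd Q.1 = odd j (+) odd l /\
  ((p < x) (+) (q < x) (+) (p < y) (+) (q < y))%N = odd j (+) odd l.
  rewrite eq_sym in jl => /(may_cross_parity PQ jl)/= [-> +]; rewrite [odd l (+) _]addbC.
  move=> <-; split=> //.
  by case: (_ < _)%N; case: (_ < _)%N; case: (_ < _)%N; case: (_ < _)%N.
rewrite /cross_poly /sign_prod !adjsignE// /psign -!signr_addb !addbA.
rewrite -[odd P.1 (+) odd Q.1 (+) odd j (+) _]addbA.
move: (may_cross sw P j Q l) (may_cross sw P l Q j) => b1 b2.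
move: (odd P.1 (+) _) (odd j (+) _) => ik jl'.
move: ((_ < _)%N (+) _ (+) _ (+) _) => x.
case: b1; case: b2 => p2 p1 ex; first by have := ex isT.
- by case: (p1 isT) => -> ->; case: jl' {p1 p2}.
- by case: (p2 isT) => -> ->; case: jl' {p1 p2}.
- by case: ik {p1 p2}; case: jl'; case: x.
Qed.

(** The order of [P] and [Q] leaves two of the four arrangements. If an outer index equals [j] or
    [l], the polynomial is 0, and every arrangement has a missing edge or is excluded by
    [may_cross_partner]. *)
Lemma crossing_tuple_le sw P j Q l : P != Q -> j != l ->
  4 * (crossing_tuple sw P j Q l + crossing_tuple sw P l Q j
     + (crossing_tuple sw Q j P l + crossing_tuple sw Q l P j))%:R <= cross_poly sw P j Q l.
Proof.
move=> PQ jl.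
have lj : l != j by rewrite eq_sym.
have QP : Q != P by rewrite eq_sym.
have [w0|] := boolP [|| P.1 == j, P.1 == l, Q.1 == j | Q.1 == l].
  have -> : cross_poly sw P j Q l = 0.
    have w00 : sign_prod sw P j Q l = 0.
      by rewrite /sign_prod /adjsign /ordsign; case/or4P: w0 => ->; rewrite ?(mul0r, mulr0).
    by rewrite /cross_poly w00 expr0n /= !mul0r addr0.
  have part A x B y : A != B -> x != y -> (A.1 == y) || (B.1 == x) ->
      crossing_tuple sw A x B y = false.
    move=> AB xy h; apply/negP => /and5P[_ Ax By _ c].
    case/orP: h => /eqP h.
      have := may_cross_sym AB xy c; rewrite -h; apply/negP/may_cross_partner; last by [].
      by rewrite h.
    move: c; rewrite -h; apply/negP/may_cross_partner; last by [].
    by rewrite h.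
  have edge A x B y : (A.1 == x) || (B.1 == y) -> crossing_tuple sw A x B y = false.
    by rewrite /crossing_tuple; case/orP => ->; rewrite /= ?andbF.
  have gF A x B y : A != B -> x != y ->
      [|| A.1 == x, A.1 == y, B.1 == x | B.1 == y] -> crossing_tuple sw A x B y = false.
    move=> AB xy /or4P[] h; [apply: edge|apply: part|apply: part|apply: edge];
      by rewrite // h ?orbT.
  by rewrite !gF// -?[X in is_true X]orbA; case/or4P: w0 => ->; rewrite ?orbT.
rewrite !negb_or => /and4P[Pj Pl Qj Ql].
rewrite /crossing_tuple Pj Pl Qj Ql jl lj /=.
have pq : outer_pos sw P != outer_pos sw Q by rewrite (inj_eq (@outer_pos_inj sw)).
rewrite (ltn_swap pq); case: (_ < _)%N => /=.
  by rewrite !addn0; exact: may_cross_le.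
have -> : cross_poly sw P j Q l = cross_poly sw Q j P l.
  by rewrite /cross_poly /sign_prod; ring.
by rewrite !add0n; exact: may_cross_le.
Qed.

(** * Counting crossings by sums of signs *)

Lemma psign_mul i : psign i * psign i = 1.
Proof. by rewrite /psign; case: odd. Qed.

Lemma ordsign_diag i : ordsign i i = 0.
Proof. by rewrite /ordsign eqxx. Qed.

Lemma ordsign0 i : i != 0%N -> ordsign i 0 = 1.
Proof. by rewrite /ordsign => /negPf->; rewrite ltn0. Qed.

Lemma ordsignC i j : ordsign i j = - ordsign j i.
Proof. by rewrite /ordsign eq_sym; case: ltngtP. Qed.

Lemma sum_psign n : \sum_(j < n) psign j = (odd n)%:R.
Proof.
elim: n => [|n IH]; first by rewrite big_ord0.
by rewrite big_ord_recr /= IH /psign; case: odd.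
Qed.

(** The nonzero terms alternate throughout: at [i], and again at [k], one index is skipped and the
    product changes sign, and the two effects cancel. Partial sums are needed for the induction. *)
Lemma sum_ordsign_lt i k N : (i < k)%N ->
  \sum_(j < N) psign j * (ordsign i j * ordsign k j) =
  if (N <= i)%N then (odd N)%:R else
  if (N <= k)%N then 1 - (odd N)%:R else (odd N)%:R.
Proof.
move=> ik; elim: N => [|N IH]; first by rewrite big_ord0.
rewrite big_ord_recr /= IH /ordsign /psign; case: (ltngtP N i) => [Ni|iN|->]/=.
- have kN : (k == N) = false by lia.
  have kN' : (k < N)%N = false by lia.
  by rewrite kN kN'; case: odd.
- case: (ltngtP N k) => [Nk|kN|->].
  + by case: odd.
  + by case: odd.
  + by rewrite !mulr0 addr0; case: odd.
- by rewrite mul0r mulr0 addr0 ik; case: odd.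
Qed.

Lemma sum_ordsign n i k : (i < n)%N -> (k < n)%N -> i != k ->
  \sum_(j < n) psign j * (ordsign i j * ordsign k j) = (odd n)%:R.
Proof.
move=> iN kN; rewrite neq_ltn => /orP[ik|ki].
  by rewrite (sum_ordsign_lt _ ik) ifN -?ltnNge// ifN -?ltnNge.
under eq_bigr do rewrite [ordsign i _ * _]mulrC.
by rewrite (sum_ordsign_lt _ ki) ifN -?ltnNge// ifN -?ltnNge.
Qed.

Lemma sum_ordsign_diag n i : (i < n)%N ->
  \sum_(j < n) psign j * (ordsign i j * ordsign i j) = (odd n)%:R - psign i.
Proof.
move=> iN; rewrite -sum_psign (bigD1 (Ordinal iN))//= [in RHS](bigD1 (Ordinal iN))//=.
rewrite /ordsign eqxx !mulr0 add0r addrAC subrr add0r; apply: eq_bigr => j /=.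
rewrite -val_eqE /= eq_sym => /negPf->.
by case: (_ < _)%N; rewrite /= ?mulrNN ?mulr1.
Qed.

(** The exchange affects only the term at [j = 0]. *)
Lemma sum_adjsign n (sw : bool) (P Q : nat * bool) : (0 < n)%N ->
  \sum_(j < n) psign j * (adjsign sw P j * adjsign sw Q j) =
  \sum_(j < n) psign j * (ordsign P.1 j * ordsign Q.1 j) +
  ((-1) ^+ (exchanged sw P 0 (+) exchanged sw Q 0) - 1) * (ordsign P.1 0 * ordsign Q.1 0).
Proof.
case: n => // n _; rewrite !big_ord_recl /=.
rewrite (eq_bigr (fun j : 'I_n => psign (bump 0 j) *
    (ordsign P.1 (bump 0 j) * ordsign Q.1 (bump 0 j)))) => [|j _]; last first.
  by rewrite /adjsign /exchanged /= !andbF !mulr1.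
rewrite /adjsign signr_addb [psign 0]/psign /=; ring.
Qed.

(** For odd [n] the correction in [sum_adjsign] is 0 or -2, which takes 1 to 1 or -1, with the same
    square. *)
Lemma sum_adjsign_offdiag n (sw : bool) (P Q : nat * bool) : (P.1 < n)%N -> (Q.1 < n)%N ->
  P.1 != Q.1 -> (sw -> odd n) ->
  (\sum_(j < n) psign j * (adjsign sw P j * adjsign sw Q j)) ^+ 2 = (odd n)%:R.
Proof.
move=> Pn Qn PQ swn; rewrite sum_adjsign ?(leq_ltn_trans _ Pn)// sum_ordsign//.
have [P0|P0] := eqVneq P.1 0%N.
  by rewrite P0 ordsign_diag mul0r mulr0 addr0; case: odd.
have [Q0|Q0] := eqVneq Q.1 0%N.
  by rewrite Q0 ordsign_diag !mulr0 addr0; case: odd.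
rewrite !ordsign0// !mulr1.
case: sw swn => [->//|_]; first by case: (_ (+) _).
by rewrite /exchanged /= subrr addr0; case: odd.
Qed.

(** For odd [n] and without the exchange, the sum is 0 at even [i] and 2 at odd [i]; the exchange
    lowers the 2 at [i = 1] to 0. *)
Lemma sum_adjsign_diag n (sw : bool) i : (i < n)%N -> (sw -> odd n) ->
  (\sum_(j < n) psign j * (adjsign sw (i, false) j * adjsign sw (i, true) j)) ^+ 2 =
  ((odd n)%:R - psign i) ^+ 2 - 4 * (sw && (i == 1)%N)%:R.
Proof.
move=> iN swn; rewrite sum_adjsign ?(leq_ltn_trans _ iN)// sum_ordsign_diag//=.
rewrite /exchanged /= !andbF !andbT addbF; case: sw swn => [->//|_] /=.
  case: eqP => [->|_] /=; first by [].
  by rewrite subrr mul0r addr0 mulr0 subr0.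
by rewrite subrr mul0r addr0 mulr0 subr0.
Qed.

(** The vertices 0i and the vertices 2i contribute [odd n] each. If [j] or [l] is 0, the exchange
    reverses the term at 0_1: this term is 0 if the other index is 1, and otherwise the contribution
    of the 0i becomes -1 and the two cancel. *)
Lemma sum_adjsign_col n (sw : bool) (j l : nat) : (j < n)%N -> (l < n)%N -> j != l ->
  (sw -> odd n) ->
  (\sum_(P : 'I_n * bool) psign P.1 *
     (adjsign sw (val P.1, P.2) j * adjsign sw (val P.1, P.2) l)) ^+ 2 =
  4 * ((odd n)%:R - (sw && ((j == 0) && (l != 1) || (l == 0) && (j != 1))%N)%:R).
Proof.
move=> jn ln jl swn.
rewrite -(pair_big xpredT xpredT (fun (i : 'I_n) (c : bool) => psign i *
     (adjsign sw (val i, c) j * adjsign sw (val i, c) l))) /=.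
transitivity ((\sum_(i < n) psign i * (ordsign i j * ordsign i l) +
   \sum_(i < n) psign i * (ordsign i j * (-1) ^+ [&& sw, i == 1 :> nat & j == 0%N] *
      (ordsign i l * (-1) ^+ [&& sw, i == 1 :> nat & l == 0%N]))) ^+ 2).
  rewrite -big_split /=; congr (_ ^+ 2); apply: eq_bigr => i _.
  by rewrite big_bool /adjsign /exchanged /= !andbF !mulr1.
have T : \sum_(i < n) psign i * (ordsign i j * ordsign i l) = (odd n)%:R.
  by rewrite -(sum_ordsign jn ln jl); apply: eq_bigr => i _;
    rewrite ordsignC [ordsign i l]ordsignC mulrNN.
rewrite T.
have [/andP[sw1 jl0]|] := boolP (sw && ((j == 0) (+) (l == 0))%N).
  have n1 : (1 < n)%N by lia.
  rewrite (bigD1 (Ordinal n1))//= in T.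
  rewrite (bigD1 (Ordinal n1))//= sw1 /=.
  rewrite [X in _ + (_ + X)](_ : _ = (odd n)%:R - psign 1 * (ordsign 1 j * ordsign 1 l)); last first.
    rewrite -T addrAC subrr add0r; apply: eq_bigr => i.
    by rewrite -val_eqE /= => /negPf->; rewrite /= ?andbF !mulr1.
  rewrite swn// /ordsign /= ?andbT.
  by case: j l jl jl0 {jn ln T} => [|[|j]] [|[|l]].
move=> nsw.
rewrite [X in _ + X](_ : _ = (odd n)%:R); last first.
  rewrite -T; apply: eq_bigr => i _; congr (_ * _).
  rewrite mulrACA -signr_addb; move: nsw; case: sw {swn} => /=; last by rewrite mulr1.
  by case: (i == 1%N :> nat) (j == 0%N) (l == 0%N) => -[] [] //= _; rewrite mulr1.
have -> : sw && ((j == 0) && (l != 1) || (l == 0) && (j != 1))%N = false.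
  move: nsw jl; case: sw {swn} => //=.
  by case: j {jn T} => [|j]; case: l {ln} => [|l].
by rewrite subr0; case: odd.
Qed.

(** * Sums over pairs of distinct indices *)

Lemma big_offdiag (I : finType) (f : I -> I -> int) :
  \sum_(x : I * I | x.1 != x.2) f x.1 x.2 =
  \sum_i \sum_k f i k - \sum_i f i i.
Proof.
have diag : \sum_(x : I * I | x.1 == x.2) f x.1 x.2 = \sum_i f i i.
  rewrite (reindex_onto (fun i => (i, i)) fst) /= => [|[i k]/= /eqP->//].
  by apply: eq_bigl => i; rewrite eqxx.
apply/eqP; rewrite eq_sym subr_eq -diag addrC; apply/eqP; rewrite pair_big /=.
exact: (bigID (fun x : I * I => x.1 == x.2)).
Qed.

Lemma sum_offdiag (I : finType) (u : I -> int) :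
  \sum_(x : I * I | x.1 != x.2) u x.1 * u x.2 =
  (\sum_i u i) ^+ 2 - \sum_i u i ^+ 2.
Proof.
rewrite (big_offdiag (fun i k => u i * u k)) expr2 big_distrlr /=.
by congr (_ - _); apply: eq_bigr => i _; rewrite expr2.
Qed.

Lemma sum_delta n i (F : nat -> int) : (i < n)%N ->
  \sum_(j < n) F j * (i == j :> nat)%:R = F i.
Proof.
move=> iN; rewrite (bigD1 (Ordinal iN))//= eqxx mulr1 big1 ?addr0// => j.
by rewrite -val_eqE /= eq_sym => /negPf->; rewrite mulr0.
Qed.

Lemma sum_avoid n i k (F : nat -> int) : (i < n)%N -> (k < n)%N ->
  \sum_(j < n) F j * ((i != j) && (k != j))%:R =
  \sum_(j < n) F j - F i - F k + (i == k)%:R * F i.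
Proof.
move=> iN kN.
have S := sum_delta (fun j => (i == k)%:R * F j) iN.
rewrite -[in RHS]S -(sum_delta F iN) -(sum_delta F kN) -!sumrB -big_split /=.
apply: eq_bigr => j _; have [->|ik] := eqVneq i k.
  by case: (k == j :> nat) => /=; ring.
have [<-|_] := eqVneq i (j : nat); first by rewrite [k == i]eq_sym (negPf ik) /=; ring.
by case: (k == j :> nat) => /=; ring.
Qed.

Lemma adjsign_sqr sw P j : adjsign sw P j ^+ 2 = (P.1 != j)%:R.
Proof.
rewrite /adjsign /ordsign; case: eqP => _ /=; first by rewrite mul0r.
by rewrite -signr_addb sqrr_sign.
Qed.

Lemma psign_sqr i : psign i ^+ 2 = 1.
Proof. by rewrite expr2 psign_mul. Qed.

Definition site n (P : 'I_n * bool) : nat * bool := (val P.1, P.2).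

Definition adjsign_prod n (x : ('I_n * bool) * ('I_n * bool)) (sw : bool) (j : nat) : int :=
  adjsign sw (site x.1) j * adjsign sw (site x.2) j.

(** Three of the four terms of [cross_poly] factor over [j] and [l] for fixed [P] and [Q]; the last
    factors over [P] and [Q] for fixed [j] and [l]. Each sum over distinct pairs is then a square
    minus a diagonal. *)
Lemma sum_cross_poly n (sw : bool) :
  \sum_(x : ('I_n * bool) * ('I_n * bool) | x.1 != x.2)
    \sum_(y : 'I_n * 'I_n | y.1 != y.2)
      cross_poly sw (site x.1) y.1 (site x.2) y.2 =
  \sum_(x : ('I_n * bool) * ('I_n * bool) | x.1 != x.2)
    ((\sum_(j < n) ((x.1.1 != j :> nat) && (x.2.1 != j :> nat))%:R) ^+ 2
     + psign x.1.1 * psign x.2.1 *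
       ((\sum_(j < n) psign j * ((x.1.1 != j :> nat) && (x.2.1 != j :> nat))%:R) ^+ 2
        - \sum_(j < n) ((x.1.1 != j :> nat) && (x.2.1 != j :> nat))%:R)
     + (\sum_(j < n) psign j * (adjsign sw (site x.1) j * adjsign sw (site x.2) j)) ^+ 2
     - 2 * \sum_(j < n) ((x.1.1 != j :> nat) && (x.2.1 != j :> nat))%:R) +
  \sum_(y : 'I_n * 'I_n | y.1 != y.2)
    ((\sum_(P : 'I_n * bool) psign P.1 * (adjsign sw (site P) y.1 * adjsign sw (site P) y.2)) ^+ 2
     - \sum_(P : 'I_n * bool) ((P.1 != y.1 :> nat) && (P.1 != y.2 :> nat))%:R).
Proof.
transitivity (\sum_(x : ('I_n * bool) * ('I_n * bool) | x.1 != x.2)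
    \sum_(y : 'I_n * 'I_n | y.1 != y.2)
     ((adjsign_prod x sw y.1 ^+ 2 * adjsign_prod x sw y.2 ^+ 2
      + psign x.1.1 * psign x.2.1 * ((psign y.1 * adjsign_prod x sw y.1 ^+ 2) *
          (psign y.2 * adjsign_prod x sw y.2 ^+ 2))
      + (psign y.1 * adjsign_prod x sw y.1) * (psign y.2 * adjsign_prod x sw y.2))
      + (psign x.1.1 * (adjsign sw (site x.1) y.1 * adjsign sw (site x.1) y.2)) *
        (psign x.2.1 * (adjsign sw (site x.2) y.1 * adjsign sw (site x.2) y.2)))).
  apply: eq_bigr => x _; apply: eq_bigr => y _.
  by rewrite /cross_poly /sign_prod /adjsign_prod /=; ring.
under eq_bigr do rewrite big_split /=.
rewrite big_split /=; congr (_ + _).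
  apply: eq_bigr => x _; rewrite !big_split /= -mulr_sumr.
  rewrite (sum_offdiag (fun j : 'I_n => adjsign_prod x sw j ^+ 2)).
  rewrite (sum_offdiag (fun j : 'I_n => psign j * adjsign_prod x sw j ^+ 2)).
  rewrite (sum_offdiag (fun j : 'I_n => psign j * adjsign_prod x sw j)).
  have rE (j : 'I_n) : adjsign_prod x sw j ^+ 2 = ((x.1.1 != j :> nat) && (x.2.1 != j :> nat))%:R.
    by rewrite /adjsign_prod exprMn !adjsign_sqr /=; do 2 case: (_ == _).
  have bE (b : bool) : (b%:R : int) ^+ 2 = b%:R by case: b.
  rewrite /= (eq_bigr _ (fun j _ => rE j)).
  rewrite (eq_bigr (fun j : 'I_n => ((x.1.1 != j :> nat) && (x.2.1 != j :> nat))%:R)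
    (F1 := fun j : 'I_n => (adjsign_prod x sw j ^+ 2) ^+ 2)); last by move=> j _; rewrite rE bE.
  rewrite (eq_bigr (fun j : 'I_n => psign j * ((x.1.1 != j :> nat) && (x.2.1 != j :> nat))%:R)
    (F1 := fun j : 'I_n => psign j * adjsign_prod x sw j ^+ 2)); last by move=> j _; rewrite rE.
  rewrite (eq_bigr (fun j : 'I_n => ((x.1.1 != j :> nat) && (x.2.1 != j :> nat))%:R)
    (F1 := fun j : 'I_n => (psign j * adjsign_prod x sw j ^+ 2) ^+ 2)); last first.
    by move=> j _; rewrite exprMn psign_sqr rE bE mul1r.
  rewrite (eq_bigr (fun j : 'I_n => ((x.1.1 != j :> nat) && (x.2.1 != j :> nat))%:R)
    (F1 := fun j : 'I_n => (psign j * adjsign_prod x sw j) ^+ 2)); last first.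
    by move=> j _; rewrite exprMn psign_sqr rE mul1r.
  by rewrite /adjsign_prod; ring.
rewrite exchange_big /=; apply: eq_bigr => y _.
rewrite (sum_offdiag (fun P : 'I_n * bool =>
  psign P.1 * (adjsign sw (site P) y.1 * adjsign sw (site P) y.2))).
congr (_ - _); apply: eq_bigr => P _.
by rewrite /= exprMn psign_sqr mul1r exprMn !adjsign_sqr /=; do 2 case: (_ != _).
Qed.

Lemma sum_site n (F : nat -> int) :
  \sum_(P : 'I_n * bool) F P.1 = 2 * \sum_(i < n) F i.
Proof.
rewrite -(pair_big xpredT xpredT (fun (i : 'I_n) (c : bool) => F i)) /=.
by rewrite mulr_sumr; apply: eq_bigr => i _; rewrite big_bool /= mulr_natl mulr2n.
Qed.

Lemma sum_const n (a : int) : \sum_(i < n) a = n%:R * a.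
Proof. by rewrite sumr_const card_ord mulr_natl. Qed.

Lemma count_avoid n i k : (i < n)%N -> (k < n)%N ->
  \sum_(j < n) ((i != j) && (k != j))%:R = n%:R - 2 + (i == k)%:R :> int.
Proof.
move=> iN kN; have := sum_avoid (fun=> 1) iN kN.
under eq_bigr do rewrite mul1r.
by move=> ->; rewrite sum_const mulr1; ring.
Qed.

Lemma sum_bilinear n (A B D : int) :
  \sum_(i < n) \sum_(k < n) (A + B * (psign i * psign k) + D * (psign i + psign k)) =
  A * n%:R ^+ 2 + B * (odd n)%:R + 2 * D * n%:R * (odd n)%:R.
Proof.
under eq_bigr => i _.
  rewrite !big_split /= sum_const -!mulr_sumr big_split /= sum_const sum_psign.
  over.
rewrite !big_split /= sum_const -mulr_sumr -mulr_suml sum_psign -mulr_sumr.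
rewrite big_split /= -mulr_sumr sum_psign sum_const.
by case: odd => /=; ring.
Qed.

(** An ordered pair of distinct indices comes from four pairs of outer vertices, an equal pair from
    only two, as the vertices must differ. *)
Lemma sum_site_pairs n (A B D : int) (F : nat -> int) :
  \sum_(x : ('I_n * bool) * ('I_n * bool) | x.1 != x.2)
    (if x.1.1 == x.2.1 :> nat then F x.1.1
     else A + B * (psign x.1.1 * psign x.2.1) + D * (psign x.1.1 + psign x.2.1)) =
  4 * (A * n%:R ^+ 2 + B * (odd n)%:R + 2 * D * n%:R * (odd n)%:R)
  - 4 * (n%:R * (A + B) + 2 * D * (odd n)%:R) + 2 * \sum_(i < n) F i.
Proof.
set f := fun i k => A + B * (psign i * psign k) + D * (psign i + psign k).
rewrite (big_offdiag (fun P Q : 'I_n * bool => if P.1 == Q.1 :> nat then F P.1 else f P.1 Q.1)) /=.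
rewrite (eq_bigr (fun P : 'I_n * bool =>
    2 * (\sum_(k < n) f P.1 k + (F P.1 - f P.1 P.1)))); last first.
  move=> P _; rewrite (@sum_site n (fun k => if P.1 == k :> nat then F P.1 else f P.1 k)).
  congr (2 * _); rewrite -[F _ - _](sum_delta (fun k => F P.1 - f P.1 k) (ltn_ord P.1)).
  rewrite -big_split /=; apply: eq_bigr => k _.
  by case: eqP => _ /=; ring.
rewrite (@sum_site n (fun i => 2 * (\sum_(k < n) f i k + (F i - f i i)))).
under [X in _ - X]eq_bigr do rewrite eqxx.
rewrite (@sum_site n F) -mulr_sumr big_split /= sumrB sum_bilinear.
rewrite [\sum_(i < n) f i i](_ : _ = n%:R * (A + B) + 2 * D * (odd n)%:R); first by ring.
rewrite -sum_psign -sum_const mulr_sumr -big_split /=; apply: eq_bigr => i _.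
by rewrite /f psign_mul; ring.
Qed.

Lemma sum_cols n (sw : bool) : (sw -> odd n) -> (1 < n)%N ->
  \sum_(y : 'I_n * 'I_n | y.1 != y.2)
    ((\sum_(P : 'I_n * bool) psign P.1 * (adjsign sw (site P) y.1 * adjsign sw (site P) y.2)) ^+ 2
     - \sum_(P : 'I_n * bool) ((P.1 != y.1 :> nat) && (P.1 != y.2 :> nat))%:R) =
  (4 * (odd n)%:R - 2 * (n%:R - 2)) * (n%:R * (n%:R - 1)) - 8 * sw%:R * (n%:R - 2).
Proof.
move=> swn n1.
(* [z] and [o] mark the indices 0 and 1. For distinct indices the exchange lowers [f] by 4 when one
   is 0 and the other is not 1, that is for 2 (n - 2) ordered pairs. *)
set z := fun j => (0%N == j)%:R : int; set o := fun j => (1%N == j)%:R : int.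
set f := fun j l => 4 * (odd n)%:R - 2 * (n%:R - 2)
  - 4 * sw%:R * (z j * (1 - o l) + z l * (1 - o j)).
rewrite (eq_bigr (fun y : 'I_n * 'I_n => f y.1 y.2)); last first.
  move=> [j l] /=; rewrite -val_eqE /= => jl; rewrite sum_adjsign_col//.
  rewrite (@sum_site n (fun i => ((i != j) && (i != l))%:R)).
  rewrite (eq_bigr (fun i : 'I_n => ((j != i :> nat) && (l != i :> nat))%:R)); last first.
    by move=> i _; rewrite (eq_sym (i : nat) j) (eq_sym (i : nat) l).
  rewrite (count_avoid (ltn_ord j) (ltn_ord l)) (negPf jl) /f /z /o.
  move: jl; case: (sw) => /=; last by move=> _; ring.
  by case: (nat_of_ord j) (nat_of_ord l) => [|[|j']] [|[|l']] //= _; ring.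
rewrite (big_offdiag (fun j l : 'I_n => f j l)).
have n0 : (0 < n)%N := ltnW n1.
have zE : \sum_(j < n) z j = 1.
  by rewrite -[RHS](sum_delta (fun=> 1) n0); apply: eq_bigr => j _; rewrite mul1r.
have oE : \sum_(j < n) o j = 1.
  by rewrite -[RHS](sum_delta (fun=> 1) n1); apply: eq_bigr => j _; rewrite mul1r.
have zo j : z j * (1 - o j) = z j by case: j => [|[|j]]; rewrite /z /o /=; ring.
rewrite [X in X - _](_ : _ = \sum_(j < n) (n%:R * (4 * (odd n)%:R - 2 * (n%:R - 2)) -
    4 * sw%:R * (z j * (n%:R - 1) + (1 - o j)))); last first.
  apply: eq_bigr => j _; rewrite /f sumrB sum_const -mulr_sumr big_split /=.
  by rewrite -mulr_sumr -mulr_suml sumrB sum_const mulr1 zE oE mul1r.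
rewrite sumrB sum_const -mulr_sumr big_split /= -mulr_suml zE sumrB sum_const oE.
rewrite [X in _ - X](_ : _ = n%:R * (4 * (odd n)%:R - 2 * (n%:R - 2)) -
    4 * sw%:R * 2); first by ring.
rewrite /f sumrB sum_const -mulr_sumr; congr (_ - _ * _).
under eq_bigr do rewrite zo.
by rewrite big_split /= zE.
Qed.

Lemma total_cross_poly n : (1 < n)%N ->
  \sum_(x : ('I_n * bool) * ('I_n * bool) | x.1 != x.2)
    \sum_(y : 'I_n * 'I_n | y.1 != y.2)
      cross_poly (odd n) (site x.1) y.1 (site x.2) y.2 =
  16 * (4 * (n %/ 2) * ((n - 1) %/ 2) * ((n - 2) %/ 2) * ((n - 3) %/ 2)
      + n * ((n - 1) %/ 2) * ((n - 2) %/ 2))%:R.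
Proof.
move=> n1; rewrite sum_cross_poly sum_cols//.
set s := (odd n)%:R : int; set N := n%:R : int.
have ss : s * s = s by rewrite /s; case: odd.
(* [F i] is the value at the pair 0i, 2i; its last term is the gain from the exchange at [i = 1]. *)
set F := fun i : nat => (N - 1) ^+ 2 + 2 * (s + 1) - 3 * (N - 1) - 4 * s * psign i
   - 4 * s * (1 == i)%N%:R.
rewrite (eq_bigr (fun x : ('I_n * bool) * ('I_n * bool) =>
  if x.1.1 == x.2.1 :> nat then F x.1.1 else
  ((N - 2) ^+ 2 + 2 + s - 2 * (N - 2)) +
  (s + 2 - (N - 2)) * (psign x.1.1 * psign x.2.1) +
  (- 2 * s) * (psign x.1.1 + psign x.2.1))); last first.
  move=> [[i c] [k d]] /= PQ.
  rewrite (count_avoid (ltn_ord i) (ltn_ord k)).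
  rewrite (sum_avoid _ (ltn_ord i) (ltn_ord k)) sum_psign.
  have [ik|ik] := eqVneq (i : nat) (k : nat); last first.
    rewrite (@sum_adjsign_offdiag n (odd n) (site (i, c)) (site (k, d)) (ltn_ord i)
      (ltn_ord k) ik id).
    rewrite -/s -/N mul0r addr0 /=.
    have pi := psign_sqr i; have pk := psign_sqr k.
    set p := psign i in pi *; set q := psign k in pk *.
    transitivity ((N - 2) ^+ 2 + (p * q * (s * s) + p ^+ 2 * p * q + q ^+ 2 * q * p
      - 2 * s * p ^+ 2 * q - 2 * s * q ^+ 2 * p + 2 * p ^+ 2 * q ^+ 2 - p * q * (N - 2))
      + s - 2 * (N - 2)); first by rewrite /=; ring.
    by rewrite ss pi pk; ring.
  have S : (\sum_(j < n) psign j * (adjsign (odd n) (site (i, c)) j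
       * adjsign (odd n) (site (k, d)) j)) ^+ 2 =
      (s - psign i) ^+ 2 - 4 * (odd n && (i == 1 :> nat)%N)%:R.
    have ik' : i = k by apply: val_inj.
    rewrite -(sum_adjsign_diag (ltn_ord i) (@id (odd n))) -ik'.
    move: PQ; rewrite -ik' xpair_eqE eqxx /=.
    case: c d => -[] // _; congr (_ ^+ 2); apply: eq_bigr => j _.
    by rewrite [adjsign _ (site (i, true)) _ * _]mulrC.
  rewrite S -ik mul1r subrK -/s -/N psign_mul mul1r /F.
  have -> : (odd n && (i == 1 :> nat)%N)%:R = s * (1 == i :> nat)%N%:R :> int.
    by rewrite /s eq_sym; case: odd; rewrite /= ?mul1r ?mul0r.
  have pi := psign_sqr i; move: pi; move: (psign i) (_ == _) => p b pi.
  transitivity ((N - 1) ^+ 2 + 2 * (s * s) - 4 * s * p + 2 * p ^+ 2 - 3 * (N - 1)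
    - 4 * (s * b%:R)); first by rewrite /=; ring.
  by rewrite ss pi; ring.
rewrite sum_site_pairs -/s -/N.
have FE : \sum_(i < n) F i =
    N * ((N - 1) ^+ 2 + 2 * (s + 1) - 3 * (N - 1)) - 4 * s * s - 4 * s.
  rewrite /F; move: (_ - 3 * (N - 1)) => K.
  rewrite !sumrB sum_const -mulr_sumr sum_psign -/s -mulr_sumr.
  rewrite [X in _ - _ * X](_ : _ = 1) ?mulr1//.
  by rewrite -[RHS](sum_delta (fun=> 1) n1); apply: eq_bigr => j _; rewrite mul1r.
rewrite FE /N /s {F FE ss N s}.
(* Writing n = 2 m + b turns the floors into polynomials in m. *)
have := odd_double_half n; move: (odd n) (n./2) => b m nE.
case: m nE => [|m] nE; first by case: b nE n1 => <-.
case: b nE => /= nE; rewrite -{}nE.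
  rewrite [X in _ = 16 * X%:R](_ : _ =
    4 * m.+1 * m.+1 * m * m + (1 + m.+1.*2) * m.+1 * m)%N; last first.
    by congr (4 * _ * _ * _ * _ + _ * _ * _)%N; lia.
  have dE : (1 + m.+1.*2)%:R = 2 * m%:R + 3 :> int.
    by rewrite -muln2 natrD natrM -[m.+1%:R]natr1; ring.
  by rewrite !dE natrD !natrM !dE -[m.+1%:R]natr1; ring.
(* This sets apart [n = 2], where [n - 3] is truncated to 0. *)
case: m => [|m]; first by [].
rewrite [X in _ = 16 * X%:R](_ : _ =
    4 * m.+2 * m.+1 * m.+1 * m + (m.+2.*2) * m.+1 * m.+1)%N; last first.
  by congr (4 * _ * _ * _ * _ + _ * _ * _)%N; lia.
have dE : (m.+2.*2)%:R = 2 * m%:R + 4 :> int.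
  by rewrite -muln2 natrM -[m.+2%:R]natr1 -[m.+1%:R]natr1; ring.
by rewrite !dE natrD !natrM !dE -[m.+2%:R]natr1 -[m.+1%:R]natr1; ring.
Qed.

(** * The bound on the number of crossing tuples *)

Lemma sum_swap (I : finType) (F : I -> I -> int) :
  \sum_(x : I * I | x.1 != x.2) F x.1 x.2 =
  \sum_(x : I * I | x.1 != x.2) F x.2 x.1.
Proof.
rewrite (reindex_onto (fun x => (x.2, x.1)) (fun x => (x.2, x.1))) /=.
  by apply: eq_bigl => -[i k]; rewrite /= eqxx andbT eq_sym.
by case.
Qed.

(** Exchanging [P] and [Q], or [j] and [l], does not change the sum, so 16 times it is 4 times the
    sum over all four arrangements, and [crossing_tuple_le] applies termwise. *)
Lemma sum_crossing_tuple n (sw : bool) :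
  16 * \sum_(x : ('I_n * bool) * ('I_n * bool) | x.1 != x.2)
    \sum_(y : 'I_n * 'I_n | y.1 != y.2)
      (crossing_tuple sw (site x.1) y.1 (site x.2) y.2)%:R <=
  \sum_(x : ('I_n * bool) * ('I_n * bool) | x.1 != x.2)
    \sum_(y : 'I_n * 'I_n | y.1 != y.2)
      cross_poly sw (site x.1) y.1 (site x.2) y.2.
Proof.
set g := fun (P Q : 'I_n * bool) (j l : 'I_n) => (crossing_tuple sw (site P) j (site Q) l)%:R : int.
set S := \sum_(x | _) _.
pose G (P Q : 'I_n * bool) := \sum_(y : 'I_n * 'I_n | y.1 != y.2) g P Q y.1 y.2.
have E1 : S = \sum_(x : ('I_n * bool) * ('I_n * bool) | x.1 != x.2) G x.2 x.1.
  exact: (sum_swap G).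
have E2 P Q : G P Q = \sum_(y : 'I_n * 'I_n | y.1 != y.2) g P Q y.2 y.1.
  exact: (sum_swap (g P Q)).
have -> : 16 * S = \sum_(x : ('I_n * bool) * ('I_n * bool) | x.1 != x.2)
    4 * (G x.1 x.2 + G x.1 x.2 + (G x.2 x.1 + G x.2 x.1)).
  rewrite -mulr_sumr !big_split /= -E1.
  have -> : \sum_(x : ('I_n * bool) * ('I_n * bool) | x.1 != x.2) G x.1 x.2 = S by [].
  by ring.
apply: ler_sum => x x12.
rewrite {2}E2 {2}(E2 x.2 x.1) -!big_split /= mulr_sumr; apply: ler_sum => y y12.
have x12' : site x.1 != site x.2.
  by apply: contra_neq x12; case: x => -[i c] [k d] /= [/val_inj -> ->].
have := @crossing_tuple_le sw (site x.1) y.1 (site x.2) y.2 x12' y12.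
by rewrite !natrD.
Qed.

Lemma card_crossing_tuple n : (0 < n)%N ->
  (#|[set t : (('I_n * bool) * ('I_n * bool)) * ('I_n * 'I_n) |
      crossing_tuple (odd n) (site t.1.1) t.2.1 (site t.1.2) t.2.2]%SET|
   <= 4 * (n %/ 2) * ((n - 1) %/ 2) * ((n - 2) %/ 2) * ((n - 3) %/ 2)
      + n * ((n - 1) %/ 2) * ((n - 2) %/ 2))%N.
Proof.
(* For [n = 1] there are no two distinct inner vertices, hence no crossing tuple. *)
move=> n0; have [n1|n1] := ltnP 1 n; last first.
  rewrite (_ : [set _ | _]%SET = finset.set0) ?cards0//; apply/finset.setP => -[x [j l]].
  rewrite !inE /= /crossing_tuple; apply/negbTE/negP => /and5P[_ _ _ jl _].
  by have := ltn_ord j; have := ltn_ord l; lia.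
have := sum_crossing_tuple n (odd n); rewrite total_cross_poly//.
rewrite ler_pM2l// -(ler_nat int); apply: le_trans.
rewrite -sum1_card natr_sum (eq_bigl
  (fun t : (('I_n * bool) * ('I_n * bool)) * ('I_n * 'I_n) =>
   crossing_tuple (odd n) (site t.1.1) t.2.1 (site t.1.2) t.2.2)); last first.
  by move=> t; rewrite inE.
rewrite big_mkcond /= -(pair_big xpredT xpredT
  (fun (x : ('I_n * bool) * ('I_n * bool)) (y : 'I_n * 'I_n) =>
   if crossing_tuple (odd n) (site x.1) y.1 (site x.2) y.2 then 1%:R else 0 : int)) /=.
rewrite [leRHS]big_mkcond /=; apply: ler_sum => x _.
case: eqVneq => [x12|_] /=.
  by rewrite big1// => y _; rewrite /crossing_tuple x12 ltnn.
rewrite [leRHS]big_mkcond /=; apply: ler_sum => y _.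
case: eqVneq => [y12|_] /=; first by rewrite /crossing_tuple y12 eqxx !andbF.
by case: crossing_tuple.
Qed.

(** * The drawing of K_n x P_3 *)

Section KroneckerPath.
Variables (R : realType) (n : nat).

Let G := kronecker (complete_graph n) (path_graph 3).

Definition outer (P : 'I_n * bool) : G := (P.1, inord (2 * P.2)).

Definition inner (j : 'I_n) : G := (j, inord 1).

Definition vpos (v : G) : nat :=
  if v.2 == 1 :> nat then inner_pos (odd n) v.1 else outer_pos (odd n) (val v.1, v.2 == 2 :> nat).

Definition vsgn (v : G) : bool := odd v.1 (+) (v.2 == 1 :> nat).

Lemma vpos_inj : injective vpos.
Proof.
move=> [i c] [k d]; rewrite /vpos /=.
have c3 := ltn_ord c; have d3 := ltn_ord d.
case: (eqVneq (c : nat) 1%N) => c1; case: (eqVneq (d : nat) 1%N) => d1.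
- by move=> /inner_pos_inj/val_inj->; congr (_, _); apply: val_inj; rewrite /= c1 d1.
- by move/esym/eqP => e; have /negP[] := outer_inner_pos_neq (odd n) (val k, d == 2 :> nat) i.
- by move/eqP => e; have /negP[] := outer_inner_pos_neq (odd n) (val i, c == 2 :> nat) k.
move=> /outer_pos_inj[/val_inj -> cd]; congr (_, _); apply: val_inj => /=.
by lia.
Qed.

Lemma vpos_outer P : vpos (outer P) = outer_pos (odd n) (site P).
Proof. by rewrite /vpos /outer /= inordK; case: P => i []. Qed.

Lemma vpos_inner j : vpos (inner j) = inner_pos (odd n) j.
Proof. by rewrite /vpos /inner /= inordK. Qed.

Lemma vsgn_outer P : vsgn (outer P) = odd P.1.
Proof. by rewrite /vsgn /outer /= inordK; case: P => i [] /=; case: odd. Qed.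

Lemma vsgn_inner j : vsgn (inner j) = ~~ odd j.
Proof. by rewrite /vsgn /inner /= inordK// eqxx addbT. Qed.

Lemma adj_outer_inner (p q : G) : adj p q -> exists P j, P.1 != j /\
  ((p = outer P /\ q = inner j) \/ (q = outer P /\ p = inner j)).
Proof.
case: p q => [i c] [k d] /andP[/= ik cd].
have c3 := ltn_ord c; have d3 := ltn_ord d.
have E (e : 'I_3) m : e = m :> nat -> e = inord m.
  by move=> em; apply: val_inj; rewrite /= inordK -?em.
have [c1|c1] := eqVneq (c : nat) 1%N.
  exists (k, d == 2 :> nat), i; split; first by rewrite eq_sym.
  right; split; congr (_, _); apply: E => //=.
  by move: cd; rewrite /path_rel /= c1; case: eqP; lia.
exists (i, c == 2 :> nat), k; split=> //.
left; split; congr (_, _); apply: E => //=; move: cd; rewrite /path_rel /=;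
  by do ?case: eqP; lia.
Qed.

Let tau (v : G) : R := (vpos v)%:R.

Lemma tau_vpos_inj : injective tau.
Proof. by move=> u v /eqP; rewrite /tau eqr_nat => /eqP/vpos_inj. Qed.

Lemma cones_meet_may_cross P j Q l :
  uniq [:: outer P; inner j; outer Q; inner l] ->
  cones_meet tau vsgn (outer P) (inner j) (outer Q) (inner l) ->
  may_cross (odd n) (site P) j (site Q) l.
Proof.
move=> u /(cones_meet_side tau_vpos_inj u).
rewrite /side /tau !ltr_nat !vpos_outer !vpos_inner !vsgn_outer !vsgn_inner.
rewrite !addbA => -[e1 e2 e3].
by apply/and3P; split; [exact: e1|exact/eqP|exact/eqP].
Qed.

Definition crossing_of (t : (('I_n * bool) * ('I_n * bool)) * ('I_n * 'I_n)) :
    {set {set G}} :=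
  [set [set outer t.1.1; inner t.2.1]; [set outer t.1.2; inner t.2.2]]%SET.

(** An image is no larger than its source, so it suffices that every pair of edges with meeting
    cones is [crossing_of] a tuple. *)
Lemma crossing_number_kronecker :
  (crossing_number R G <=
   #|[set t : (('I_n * bool) * ('I_n * bool)) * ('I_n * 'I_n) |
       crossing_tuple (odd n) (site t.1.1) t.2.1 (site t.1.2) t.2.2]%SET|)%N.
Proof.
set A := [set t | _]%SET.
apply: leq_trans (leq_imset_card crossing_of (mem A)).
have base P Q (j l : 'I_n) : P.1 != j -> Q.1 != l ->
    uniq [:: outer P; inner j; outer Q; inner l] ->
    cones_meet tau vsgn (outer P) (inner j) (outer Q) (inner l) ->
    (outer_pos (odd n) (site P) < outer_pos (odd n) (site Q))%N ->
    [set [set outer P; inner j]; [set outer Q; inner l]]%SET \in crossing_of @: A.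
  move=> Pj Ql u m PQ; apply/imsetP; exists ((P, Q), (j, l)) => //.
  rewrite inE /crossing_tuple PQ Pj Ql (cones_meet_may_cross u m) andbT /=.
  have : j != l by apply: contraTneq u => ->; rewrite /= !inE eqxx !orbT !andbF.
  by rewrite -val_eqE.
(* The order of [P] and [Q] is no restriction: swapping the edges gives the same pair, and equal
   positions force [P = Q], against [uniq]. *)
have base' P Q (j l : 'I_n) : P.1 != j -> Q.1 != l ->
    uniq [:: outer P; inner j; outer Q; inner l] ->
    cones_meet tau vsgn (outer P) (inner j) (outer Q) (inner l) ->
    [set [set outer P; inner j]; [set outer Q; inner l]]%SET \in crossing_of @: A.
  move=> Pj Ql u m.
  have [PQ|QP|PQ] := ltngtP (outer_pos (odd n) (site P)) (outer_pos (odd n) (site Q)).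
  - exact: base.
  - rewrite finset.setUC; apply: base => //; last exact: cones_meet_swap.
    by rewrite (uniq_catC [:: _; _] [:: _; _]).
  - move: u; rewrite (_ : P = Q) ?[in X in X -> _]/= ?inE ?eqxx ?orbT//.
    move/outer_pos_inj: PQ; case: (P) (Q) => [i c] [k d] /= [/val_inj -> ->] //.
apply: (crossing_number_le_cones (sgn := vsgn) tau_vpos_inj) => p q a b.
move=> /adj_outer_inner[P [j [Pj pq]]] /adj_outer_inner[Q [l [Ql ab]]].
have flip (x y z w : G) : uniq [:: x; y; z; w] -> uniq [:: y; x; z; w].
  by move=> u; rewrite -[uniq _](uniq_catCA [:: x] [:: y] [:: z; w]).
have rot2 (x y z w : G) : uniq [:: x; y; z; w] -> uniq [:: z; w; x; y].
  by rewrite (uniq_catC [:: x; y] [:: z; w]).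
case: pq => -[-> ->]; case: ab => -[-> ->] u m.
- exact: base'.
- rewrite [X in [set _; X]%SET]finset.setUC; apply: base' => //.
    exact/rot2/flip/rot2.
  exact/cones_meet_swap/cones_meet_flip/cones_meet_swap.
- rewrite [X in [set X; _]%SET]finset.setUC; apply: base' => //.
    exact: flip.
  exact: cones_meet_flip.
- rewrite [X in [set X; _]%SET]finset.setUC [X in [set _; X]%SET]finset.setUC.
  apply: base' => //; first exact/flip/rot2/flip/rot2.
  exact/cones_meet_flip/cones_meet_swap/cones_meet_flip/cones_meet_swap.
Qed.

End KroneckerPath.

Theorem theorem3p1 (R : realType) (n : nat) (n_ge1 : (1 <= n)%N) :
  (crossing_number R (kronecker (complete_graph n) (path_graph 3))
   <= 4 * (n %/ 2) * ((n - 1) %/ 2) * ((n - 2) %/ 2) * ((n - 3) %/ 2)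
      + n * ((n - 1) %/ 2) * ((n - 2) %/ 2))%N.
Proof. exact: leq_trans (crossing_number_kronecker R n) (card_crossing_tuple n_ge1). Qed.
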